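(* Let $D$ be a rectangle in $\mathbb R^2$. Let $f=f_{asyche}:D\to\mathbb R^3$ be a $C^{1M}$ regular immersion in asymptotic Chebyshev coordinates $(x,y)$, let $\theta$, the angle from $f_x$ to $f_y$, satisfy $0<\theta<\pi$, and assume that $N:=\dfrac{f_x\times f_y}{\sin\theta}$ is $C^{1M}$, that $N_{xy}=N_{yx}=\cos\theta\,N$, and that $f_x=N\times N_x$ and $f_y=-N\times N_y$. Then there exists a $C^1$ diffeomorphism $\rho:D\to D$ such that $f_{new}=f_{asyche}\circ\rho:D\to\mathbb R^3$ is a regular $C^2$-immersion.
   Context: A rectangle is a product of two open intervals (bounded or unbounded), with coordinates $(x,y)$. A $C^1$ map $g$ is $C^{1M}$ if its mixed second partials $g_{xy},g_{yx}$ exist, are continuous and are equal. A $C^1$ map is regular if it has rank $2$ everywhere. $f$ is Chebyshev if $\langle f_x,f_x\rangle=\langle f_y,f_y\rangle=1$ and asymptotic if $\langle f_x,N_x\rangle=0=\langle f_y,N_y\rangle$. *)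

(* Defs.v *)
From HB Require Import structures.
From mathcomp Require Import all_boot all_order all_algebra.
From mathcomp Require Import all_classical all_reals all_analysis.
Set Implicit Arguments.
Unset Strict Implicit.
Unset Printing Implicit Defensive.
Import Order.TTheory GRing.Theory Num.Theory.
Import numFieldNormedType.Exports.
Local Open Scope classical_set_scope.
Local Open Scope ring_scope.

(* R^n is 'rV[R]_n; the coordinates of p : 'rV[R]_2 are x = p 0 0, y = p 0 1.
   Maps on a set D are total functions, constrained only at the points of D.
   All the sets D involved are open, so differentiability and continuity at the
   points of D depend only on the values on D. *)

Section Euclidean.
Variable R : realType.

(* The library norm on 'rV[R]_n is the sup norm, hence enorm. *)
Definition dot (u v : 'rV[R]_3) : R := \sum_(k < 3) u 0 k * v 0 k.

Definition enorm (u : 'rV[R]_3) : R := Num.sqrt (dot u u).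

(* Indices are added modulo 3. *)
Definition cross (u v : 'rV[R]_3) : 'rV[R]_3 :=
  \row_(k < 3) (u 0 (k + 1) * v 0 (k + 2) - u 0 (k + 2) * v 0 (k + 1)).

(* Within ]0, pi[ this determines t. *)
Definition is_angle (t : R) (u v : 'rV[R]_3) : Prop :=
  dot u v = enorm u * enorm v * cos t.

End Euclidean.

Section Plane.
Variable R : realType.

Definition is_rectangle (D : set 'rV[R]_2) : Prop :=
  exists a b c d : \bar R,
    [/\ (a < b)%E, (c < d)%E &
        D = [set p : 'rV[R]_2 | (a < (p 0 0)%:E < b)%E /\
                                (c < (p 0 1)%:E < d)%E]].

Definition e_x : 'rV[R]_2 := delta_mx 0 0.
Definition e_y : 'rV[R]_2 := delta_mx 0 1.

Definition dx (V : normedModType R) (g : 'rV[R]_2 -> V) : 'rV[R]_2 -> V :=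
  fun p => 'D_e_x g p.
Definition dy (V : normedModType R) (g : 'rV[R]_2 -> V) : 'rV[R]_2 -> V :=
  fun p => 'D_e_y g p.

Definition C0_on (V : normedModType R) (D : set 'rV[R]_2)
    (g : 'rV[R]_2 -> V) : Prop :=
  forall p, D p -> {for p, continuous g}.

Definition C1_on (V : normedModType R) (D : set 'rV[R]_2)
    (g : 'rV[R]_2 -> V) : Prop :=
  [/\ forall p, D p -> differentiable g p, C0_on D (dx g) & C0_on D (dy g)].

Definition C2_on (V : normedModType R) (D : set 'rV[R]_2)
    (g : 'rV[R]_2 -> V) : Prop :=
  [/\ C1_on D g, C1_on D (dx g) & C1_on D (dy g)].

(* g_xy = (g_x)_y is dy (dx g), and g_yx is dx (dy g). *)
Definition C1M_on (V : normedModType R) (D : set 'rV[R]_2)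
    (g : 'rV[R]_2 -> V) : Prop :=
  [/\ C1_on D g,
      forall p, D p -> derivable (dx g) p e_y /\ derivable (dy g) p e_x,
      C0_on D (dy (dx g)),
      C0_on D (dx (dy g)) &
      forall p, D p -> dy (dx g) p = dx (dy g) p].

Definition regular_on (D : set 'rV[R]_2) (g : 'rV[R]_2 -> 'rV[R]_3) : Prop :=
  forall p, D p -> \rank ('J g p) = 2.

Definition C1_diffeo (D : set 'rV[R]_2) (rho : 'rV[R]_2 -> 'rV[R]_2) : Prop :=
  exists sigma : 'rV[R]_2 -> 'rV[R]_2,
    [/\ forall p, D p -> D (rho p) /\ D (sigma p),
        forall p, D p -> sigma (rho p) = p /\ rho (sigma p) = p,
        C1_on D rho &
        C1_on D sigma].

Definition chebyshev_on (D : set 'rV[R]_2) (f : 'rV[R]_2 -> 'rV[R]_3) : Prop :=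
  forall p, D p -> dot (dx f p) (dx f p) = 1 /\ dot (dy f p) (dy f p) = 1.

Definition asymptotic_on (D : set 'rV[R]_2)
    (f N : 'rV[R]_2 -> 'rV[R]_3) : Prop :=
  forall p, D p -> dot (dx f p) (dx N p) = 0 /\ dot (dy f p) (dy N p) = 0.

Definition normal (theta : 'rV[R]_2 -> R) (f : 'rV[R]_2 -> 'rV[R]_3) :
    'rV[R]_2 -> 'rV[R]_3 :=
  fun p => (sin (theta p))^-1 *: cross (dx f p) (dy f p).

End Plane.

(* Main.v *)
Require Import Defs.
From HB Require Import structures.
From mathcomp Require Import all_boot all_order all_algebra.
From mathcomp Require Import all_classical all_reals all_analysis.
From mathcomp Require Import ring lra zify.
Set Implicit Arguments.
Unset Strict Implicit.
Unset Printing Implicit Defensive.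
Import Order.TTheory GRing.Theory Num.Theory.
Import numFieldNormedType.Exports.
Local Open Scope classical_set_scope.
Local Open Scope ring_scope.

(** The theorem holds for every C1 immersion [f] of a rectangle [D] whose unit
    normal [N] is C1. Such a surface is locally the graph of a C2 function,
    so the C1 structure of [D] contains a C2 structure in which [f] is C2, and
    [rho] is a C1 diffeomorphism from the usual C2 structure of [D] to that
    one. The proof constructs [rho] without charts.

    Say that a function [w] on [D] has a C1 gradient ([C1grad]) if
    [w_x = <V, f_x>] and [w_y = <V, f_y>] for some C1 map [V] to 3-space;
    these are the functions that are C2 in the finer structure. Affine
    functions of [f] are of this kind, and the class is stable under sums,
    products and composition with C2 functions of one variable. Let [u, v] be
    two such functions, with gradients [V] and [W], such that [(u, v)] is a
    diffeomorphism of [D] with inverse [rho]. The partial derivatives of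
    [f \o rho] form the basis of the tangent plane dual to [(V, W)], so they
    are [W x N / det (V, W, N)] and [N x V / det (V, W, N)], composed with
    [rho]: these are C1, and [f \o rho] is C2 ([dual_frame], [smoothed_C2]).

    It remains to find such [u] and [v] close to the coordinates [x] and [y].
    If the partial derivatives of [u - x] and [v - y] are at most 1/8 and the
    displacement of each point [p] is at most half the radius of a ball around
    [p] contained in [D], then [(u, v)] is a bijection of the convex set [D],
    by a contraction argument, and its inverse is C1 ([planar_surj], [C1_rho]).

    Near a point [c], the function [x(c) + <V(c), f - f(c)>], where [V(c)] is
    dual to the frame [(f_x, f_y)] at [c], agrees with [x] to first order
    ([close_affine_at]). Functions of this kind attached to the points of a
    grid of mesh [r] are glued by interpolating between neighbours with a step
    function applied to one of the approximate coordinates themselves, so that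
    the gradient stays C1 ([ladder], [C1grad_ladder]). The slope of the step is
    of order [1 / r] while the errors are [o(r)], so two passes, one for each
    direction, multiply the errors of the derivatives by a universal constant:
    on a compact set, any precision can be reached ([local_approx]). A third
    ladder, along the levels of a proper function on [D], glues approximations
    on an exhaustion of [D] by compact boxes, whose precisions are chosen in
    advance against the slopes of the steps ([global_approx]). *)

(** * Continuity, planar points and first-order expansions *)

Section Continuity.
Variables (R : realType) (T : topologicalType).
Implicit Types (s t : T -> R) (x : T).

Definition cont_at (U : topologicalType) (s : T -> U) x : Prop :=
  {for x, continuous s}.

Lemma contD s t x : cont_at s x -> cont_at t x ->
  cont_at (fun y => s y + t y) x.
Proof. by move=> cs ct; exact: (continuousD cs ct). Qed.

Lemma contB s t x : cont_at s x -> cont_at t x ->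
  cont_at (fun y => s y - t y) x.
Proof. by move=> cs ct; exact: (continuousB cs ct). Qed.

Lemma contN s x : cont_at s x -> cont_at (fun y => - s y) x.
Proof. by move=> cs; exact: (continuousN cs). Qed.

Lemma contM s t x : cont_at s x -> cont_at t x ->
  cont_at (fun y => s y * t y) x.
Proof. by move=> cs ct; exact: (continuousM cs ct). Qed.

Lemma contV s x : s x != 0 -> cont_at s x -> cont_at (fun y => (s y)^-1) x.
Proof. by move=> s0 cs; exact: (continuousV s0 cs). Qed.

Lemma cont_cst c x : cont_at (fun=> c : R) x.
Proof. exact: cst_continuous. Qed.

Lemma cont_sum n (s : 'I_n -> T -> R) x :
  (forall k, cont_at (s k) x) -> cont_at (fun y => \sum_(k < n) s k y) x.
Proof.
elim: n s => [|n IH] s H.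
  have -> : (fun y => \sum_(k < 0) s k y) = fun=> 0.
    by apply/funext => y; rewrite big_ord0.
  exact: cont_cst.
have -> : (fun y => \sum_(k < n.+1) s k y) =
   (fun y => \sum_(k < n) s (widen_ord (leqnSn n) k) y + s ord_max y).
  by apply/funext => y; rewrite big_ord_recr.
by apply: contD; [apply: IH => k; exact: H|exact: H].
Qed.

Lemma cont_near (U : topologicalType) (s t : T -> U) x :
  (\forall y \near x, s y = t y) -> cont_at s x -> cont_at t x.
Proof.
move=> st; rewrite /cont_at /prop_for /continuous_at -(nbhs_singleton st).
by apply: cvg_trans; apply: near_eq_cvg; apply: filterS st => y ->.
Qed.

Lemma cont_comp (U V : topologicalType) (s : T -> U) (t : U -> V) x :
  cont_at s x -> {for s x, continuous t} -> cont_at (t \o s) x.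
Proof. by move=> cs ct; exact: (continuous_comp cs ct). Qed.
End Continuity.

Section FirstOrder.
Variable R : realType.
Notation pt := 'rV[R]_2.
Implicit Types (p q h : pt) (w : pt -> R).

Lemma ord2P (P : 'I_2 -> Prop) : P 0 -> P 1 -> forall k, P k.
Proof.
move=> P0 P1 [[|[|//]] Hk].
- by rewrite (_ : Ordinal Hk = 0) //; apply/val_inj.
- by rewrite (_ : Ordinal Hk = 1) //; apply/val_inj.
Qed.

Lemma ptB (a b : pt) j : (a - b) 0 j = a 0 j - b 0 j.
Proof. by rewrite !mxE. Qed.

Lemma pt_norm_lt p (e : R) : 0 < e ->
  (`|p| < e) = (`|p 0 0| < e) && (`|p 0 1| < e).
Proof.
move=> e0; rewrite [`|p|]/Num.Def.normr/= mx_normrE.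
apply/idP/andP => [/bigmax_ltP[_ H]|[H0 H1]].
  by split; [exact: (H (0, 0))|exact: (H (0, 1))].
apply/bigmax_ltP; split => // -[i j] _ /=; rewrite (ord1 i).
by move: j; apply: ord2P.
Qed.

Lemma pt_coord_le p : `|p 0 0| <= `|p| /\ `|p 0 1| <= `|p|.
Proof.
rewrite [`|p|]/Num.Def.normr/= mx_normrE; split.
- exact: (@le_bigmax _ _ _ 0 (fun ij : 'I_1 * 'I_2 => `|p ij.1 ij.2|) (0, 0)).
- exact: (@le_bigmax _ _ _ 0 (fun ij : 'I_1 * 'I_2 => `|p ij.1 ij.2|) (0, 1)).
Qed.

Lemma pt_norm_le p (e : R) :
  (`|p| <= e) = (`|p 0 0| <= e) && (`|p 0 1| <= e).
Proof.
have [H0 H1] := pt_coord_le p.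
apply/idP/andP => [H|[H2 H3]]; first by split; exact: le_trans H.
rewrite [`|p|]/Num.Def.normr/= mx_normrE.
apply/bigmax_leP; split; first exact: le_trans H2.
by move=> -[i j] _ /=; rewrite (ord1 i); move: j; apply: ord2P.
Qed.

Lemma near_to0 p (P : set pt) :
  (\forall z \near p, P z) -> \forall h \near (0 : pt), P (h + p).
Proof.
move=> /nbhs_ballP[e /= e0 H]; apply/nbhs_ballP; exists e => // h.
rewrite -ball_normE /= sub0r normrN => he; apply: H.
by rewrite -ball_normE /= opprD addrCA subrr addr0 normrN.
Qed.

Lemma near_of0 p (P : set pt) :
  (\forall h \near (0 : pt), P h) -> \forall z \near p, P (z - p).
Proof.
move=> /nbhs_ballP[e /= e0 H]; apply/nbhs_ballP; exists e => // h.
rewrite -ball_normE /= => he; apply: H.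
by rewrite -ball_normE /= sub0r normrN distrC.
Qed.

Lemma pt_decomp p : p = p 0 0 *: e_x R + p 0 1 *: e_y R.
Proof.
apply/rowP; apply: ord2P; rewrite !mxE /= mulr1 mulr0; first by rewrite addr0.
by rewrite add0r.
Qed.

Definition partials w p (a b : R) :=
  [/\ differentiable w p, dx w p = a & dy w p = b].

Definition lin2 (a b : R) : pt -> R := fun h => h 0 0 * a + h 0 1 * b.

Lemma lin2_linear a b : linear (lin2 a b).
Proof. by move=> k u v; rewrite /lin2 !mxE /GRing.scale /=; ring. Qed.
HB.instance Definition _ a b :=
  GRing.isLinear.Build R pt R _ (lin2 a b) (lin2_linear a b).

Lemma lin2_continuous a b : continuous (lin2 a b).
Proof.
move=> p; suff : cont_at (lin2 a b : pt -> R) p by [].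
by apply: contD; apply: contM;
  [exact: coord_continuous|exact: cont_cst|
   exact: coord_continuous|exact: cont_cst].
Qed.

Lemma diff_lin2 w p h : differentiable w p ->
  'd w p h = h 0 0 * dx w p + h 0 1 * dy w p.
Proof.
move=> dw; rewrite {1}(pt_decomp h) linearD !linearZ /dx /dy.
by rewrite !deriveE.
Qed.

(** The first-order expansion characterizes the differential because a
    linear form on the plane is determined by its values on the two axes. *)
Lemma partialsP w p a b : partials w p a b <->
  forall e, 0 < e -> \forall h \near (0 : pt),
    `|w (h + p) - w p - (h 0 0 * a + h 0 1 * b)| <= e * `|h|.
Proof.
split=> [[dw <- <-] e e0|H].
  have /diff_locally/eqaddoP/(_ _ e0) := dw.
  apply: filterS => h; apply: le_trans; rewrite -diff_lin2 // -addrA -opprD.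
  exact: lexx.
have E : w \o shift p = cst (w p) + lin2 a b +o_ (0 : pt) id.
  apply/eqaddoP => e /H; apply: filterS => h; apply: le_trans.
  by rewrite -addrA -opprD; exact: lexx.
have D := diff_unique (@lin2_continuous a b) E.
have dw : differentiable w p.
  by apply/diff_locallyP; rewrite D; split => //; exact: lin2_continuous.
split => //; rewrite /dx /dy deriveE // D.
- by rewrite -[LHS]/(lin2 a b (e_x R)) /lin2 /e_x !mxE /= mul1r mul0r addr0.
- by rewrite -[LHS]/(lin2 a b (e_y R)) /lin2 /e_y !mxE /= mul1r mul0r add0r.
Qed.

Lemma partials_diff w p : differentiable w p -> partials w p (dx w p) (dy w p).
Proof. by []. Qed.

Lemma partials_continuous w p a b : partials w p a b -> cont_at w p.
Proof. by case=> dw _ _; exact: differentiable_continuous. Qed.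

Lemma partials_cst c p : partials (fun=> c) p 0 0.
Proof.
apply/partialsP => e e0; near=> h.
by rewrite subrr !mulr0 addr0 subrr normr0 mulr_ge0 // ltW.
Unshelve. all: by end_near. Qed.

Lemma partials_x p : partials (fun q => q 0 0) p 1 0.
Proof.
apply/partialsP => e e0; near=> h.
by rewrite !mxE mulr1 mulr0 addr0 addrK subrr normr0 mulr_ge0 // ltW.
Unshelve. all: by end_near. Qed.

Lemma partials_y p : partials (fun q => q 0 1) p 0 1.
Proof.
apply/partialsP => e e0; near=> h.
by rewrite !mxE mulr1 mulr0 add0r addrK subrr normr0 mulr_ge0 // ltW.
Unshelve. all: by end_near. Qed.

Lemma partials_eq w p a b a' b' : partials w p a b -> a = a' -> b = b' -> partials w p a' b'.
Proof. by move=> H <- <-. Qed.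

Lemma partials_near w w' p a b : (\forall q \near p, w q = w' q) ->
  partials w p a b -> partials w' p a b.
Proof.
move=> ww' /partialsP H; apply/partialsP => e e0.
have E0 := nbhs_singleton ww'.
have : \forall h \near (0 : pt), w (h + p) = w' (h + p).
  have := ww'; rewrite (near_shift 0 p) subr0.
  by apply: filterS => h /=.
by apply: filterS2 (H e e0) => h + E; rewrite E E0.
Qed.

Lemma partialsD w1 w2 p a1 b1 a2 b2 : partials w1 p a1 b1 -> partials w2 p a2 b2 ->
  partials (fun q => w1 q + w2 q) p (a1 + a2) (b1 + b2).
Proof.
move=> [D1 <- <-] [D2 <- <-]; split; first exact: differentiableD.
- by rewrite /dx deriveD //; exact: diff_derivable.
- by rewrite /dy deriveD //; exact: diff_derivable.
Qed.

Lemma partialsM w1 w2 p a1 b1 a2 b2 : partials w1 p a1 b1 -> partials w2 p a2 b2 ->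
  partials (fun q => w1 q * w2 q) p
     (w1 p * a2 + w2 p * a1) (w1 p * b2 + w2 p * b1).
Proof.
move=> [D1 <- <-] [D2 <- <-]; split; first exact: differentiableM.
- by rewrite /dx deriveM //; exact: diff_derivable.
- by rewrite /dy deriveM //; exact: diff_derivable.
Qed.

Lemma partials_sum n (w : 'I_n -> pt -> R) p (a b : 'I_n -> R) :
  (forall k, partials (w k) p (a k) (b k)) ->
  partials (fun q => \sum_(k < n) w k q) p (\sum_(k < n) a k) (\sum_(k < n) b k).
Proof.
elim: n w a b => [|n IH] w a b H.
  have -> : (fun q => \sum_(k < 0) w k q) = fun=> 0.
    by apply/funext => q; rewrite big_ord0.
  by rewrite !big_ord0; exact: partials_cst.
have -> : (fun q => \sum_(k < n.+1) w k q) =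
   (fun q => \sum_(k < n) w (widen_ord (leqnSn n) k) q + w ord_max q).
  by apply/funext => q; rewrite big_ord_recr.
by rewrite !big_ord_recr /=; apply: partialsD => //; apply: IH => k; exact: H.
Qed.

Lemma partials_comp (s : R -> R) w p a b s' : is_derive (w p) 1 s s' ->
  partials w p a b -> partials (fun q => s (w q)) p (s' * a) (s' * b).
Proof.
move=> [ds <-] [D <- <-].
have dsf : differentiable s (w p) by apply/derivable1_diffP.
split; first exact: differentiable_comp.
- rewrite /dx deriveE; last exact: differentiable_comp.
  rewrite diff_comp //= (deriveE (e_x R) D) diff1E // derive1E.
  by rewrite /GRing.scale /= mulrC.
- rewrite /dy deriveE; last exact: differentiable_comp.
  rewrite diff_comp //= (deriveE (e_y R) D) diff1E // derive1E.
  by rewrite /GRing.scale /= mulrC.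
Qed.

Lemma differentiable_rowP n (g : pt -> 'rV[R]_n) p :
  differentiable g p <-> forall k, differentiable (fun q => g q 0 k) p.
Proof.
split=> [dg k|H].
  apply: (@differentiable_comp _ _ _ _ g (fun r : 'rV[R]_n => r 0 k)) => //.
  exact: differentiable_coord.
have -> : g = \sum_(k < n) (fun q => g q 0 k *: delta_mx 0 k).
  apply/funext => q; rewrite fct_sumE [LHS]row_sum_delta.
  by [].
by apply: differentiable_sum => k; exact: differentiableZl.
Qed.

Lemma derive_row n (g : pt -> 'rV[R]_n) p v k : differentiable g p ->
  ('D_v g p) 0 k = 'D_v (fun q => g q 0 k) p.
Proof. by move=> dg; rewrite derive_mx ?mxE //; exact: diff_derivable. Qed.

Lemma continuous_rowP n (g : pt -> 'rV[R]_n) p :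
  cont_at g p <-> forall k, cont_at (fun q => g q 0 k) p.
Proof.
split=> [cg k|H].
  apply: (cont_comp (t := fun r : 'rV[R]_n => r 0 k) cg).
  exact: coord_continuous.
have -> : g = \sum_(k < n) (fun q => g q 0 k *: delta_mx 0 k).
  by apply/funext => q; rewrite fct_sumE [LHS]row_sum_delta.
elim/big_ind : _ => [|f1 f2 c1 c2|k _].
- exact: cst_continuous.
- exact: continuousD.
- by apply: continuousZr_tmp; exact: H.
Qed.

Lemma partials_comp2 w (r : pt -> pt) p a b ux uy vx vy :
  partials w (r p) a b -> partials (fun q => r q 0 0) p ux uy ->
  partials (fun q => r q 0 1) p vx vy ->
  partials (fun q => w (r q)) p (a * ux + b * vx) (a * uy + b * vy).
Proof.
move=> [dw <- <-] [du <- <-] [dv <- <-].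
have dr : differentiable r p.
  by apply/differentiable_rowP; apply: ord2P.
have dc : differentiable (fun q => w (r q)) p by exact: differentiable_comp.
have E v : 'D_v (fun q => w (r q)) p = 'D_v (fun q => r q 0 0) p * dx w (r p)
    + 'D_v (fun q => r q 0 1) p * dy w (r p).
  rewrite (deriveE _ dc) (diff_comp dr dw) /= (diff_lin2 _ dw).
  by rewrite -(deriveE _ dr) !(derive_row _ _ dr).
by split => //; rewrite /dx /dy E; congr (_ + _); exact: mulrC.
Qed.
End FirstOrder.

(** * C1 functions, and functions with a C1 ambient gradient *)

Section C1At.
Variable R : realType.
Notation pt := 'rV[R]_2.
Implicit Types (p q h : pt) (w : pt -> R).

(** The condition is imposed on a neighbourhood, so that it is a local
    property and agrees with [C1_on] on open sets. *)
Definition C1_at w p := \forall q \near p,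
  [/\ differentiable w q, cont_at (dx w) q &
      cont_at (dy w) q].

Lemma C1_atI w (a b : pt -> R) p :
  (\forall q \near p, partials w q (a q) (b q)) ->
  (\forall q \near p, cont_at a q) ->
  (\forall q \near p, cont_at b q) -> C1_at w p.
Proof.
move=> /near_join H; apply: filterS3 H => q H ca cb.
have [dw _ _] := nbhs_singleton H; split; first exact: dw.
- by apply: cont_near ca; apply: filterS H => r [].
- by apply: cont_near cb; apply: filterS H => r [].
Qed.

Lemma C1_at_partials w p : C1_at w p -> partials w p (dx w p) (dy w p).
Proof. by move=> /nbhs_singleton[]. Qed.

Lemma C1_at_cont w p : C1_at w p -> cont_at w p.
Proof. by move=> /C1_at_partials/partials_continuous. Qed.

Lemma C1_at_near_cont w p : C1_at w p -> \forall q \near p, cont_at w q.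
Proof. by apply: filterS => q [dw _ _]; exact: differentiable_continuous. Qed.

Lemma C1_at_eq w w' p : (\forall q \near p, w q = w' q) -> C1_at w p -> C1_at w' p.
Proof.
move=> /near_join E H; apply: (@C1_atI _ (dx w) (dy w)).
- apply: filterS2 E H => q E [dw _ _].
  exact: partials_near E _.
- by apply: filterS H => q [_ c _]; exact: c.
- by apply: filterS H => q [_ _ c]; exact: c.
Qed.

Lemma C1_at_cst c p : C1_at (fun=> c) p.
Proof.
apply: (@C1_atI _ (fun=> 0) (fun=> 0)); near=> q.
- exact: partials_cst.
- exact: cst_continuous.
- exact: cst_continuous.
Unshelve. all: by end_near. Qed.

Lemma C1_atD w1 w2 p : C1_at w1 p -> C1_at w2 p ->
  C1_at (fun q => w1 q + w2 q) p.
Proof.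
move=> H1 H2.
apply: (@C1_atI _ (fun q => dx w1 q + dx w2 q) (fun q => dy w1 q + dy w2 q)).
all: apply: filterS2 H1 H2 => q [dw1 x1 y1] [dw2 x2 y2].
- exact: (partialsD (partials_diff dw1) (partials_diff dw2)).
- exact: (contD x1 x2).
- exact: (contD y1 y2).
Qed.

Lemma C1_atM w1 w2 p : C1_at w1 p -> C1_at w2 p ->
  C1_at (fun q => w1 q * w2 q) p.
Proof.
move=> H1 H2.
apply: (@C1_atI _ (fun q => w1 q * dx w2 q + w2 q * dx w1 q)
                  (fun q => w1 q * dy w2 q + w2 q * dy w1 q)).
all: apply: filterS2 H1 H2 => q [dw1 x1 y1] [dw2 x2 y2].
- exact: (partialsM (partials_diff dw1) (partials_diff dw2)).
- have := differentiable_continuous dw1; have := differentiable_continuous dw2.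
  by move=> c2 c1; exact: (contD (contM c1 x2) (contM c2 x1)).
- have := differentiable_continuous dw1; have := differentiable_continuous dw2.
  by move=> c2 c1; exact: (contD (contM c1 y2) (contM c2 y1)).
Qed.

Lemma C1_atB w1 w2 p : C1_at w1 p -> C1_at w2 p ->
  C1_at (fun q => w1 q - w2 q) p.
Proof.
move=> H1 H2; apply: C1_at_eq (C1_atD H1 (C1_atM (C1_at_cst (-1) p) H2)).
by near=> q; rewrite mulN1r.
Unshelve. all: by end_near. Qed.

Lemma C1_at_sum n (w : 'I_n -> pt -> R) p : (forall k, C1_at (w k) p) ->
  C1_at (fun q => \sum_(k < n) w k q) p.
Proof.
elim: n w => [|n IH] w H.
  apply: C1_at_eq (C1_at_cst 0 p); near=> q; by rewrite big_ord0.
apply: (@C1_at_eq (fun q => \sum_(k < n) w (widen_ord (leqnSn n) k) q + w ord_max q)).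
  by near=> q; rewrite big_ord_recr.
apply: C1_atD; last exact: H.
by apply: IH => k; exact: H.
Unshelve. all: by end_near. Qed.

Definition C1R (s s' : R -> R) (x : R) := \forall y \near x,
  is_derive (y : R) (1 : R) s (s' y) /\ cont_at s' y.

Lemma cont_near_pull (w : pt -> R) p (P : R -> Prop) :
  cont_at w p -> (\forall y \near w p, P y) ->
  \forall q \near p, P (w q).
Proof. by move=> cw; apply: cw. Qed.

Lemma C1_at_comp s s' w p : C1R s s' (w p) -> C1_at w p ->
  C1_at (fun q => s (w q)) p.
Proof.
move=> Hs H; have Hsw := cont_near_pull (C1_at_cont H) Hs.
apply: (@C1_atI _ (fun q => s' (w q) * dx w q) (fun q => s' (w q) * dy w q)).
all: apply: filterS2 H Hsw => q [dw cx cy] [ds cs].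
- exact: (partials_comp ds (partials_diff dw)).
- apply: contM; last exact: cx.
  exact: (cont_comp (differentiable_continuous dw) cs).
- apply: contM; last exact: cy.
  exact: (cont_comp (differentiable_continuous dw) cs).
Qed.

Lemma C1R_inv x : x != 0 -> C1R GRing.inv (fun y => - y ^- 2) x.
Proof.
move=> x0.
have := @open_nbhs_nbhs _ x _ (conj (@open_neq R 0) x0).
apply: filterS => y /= y0; split.
  have := is_deriveV y0 (is_derive_id y (1 : R)).
  by rewrite /GRing.scale /= mulr1.
apply: continuousN; apply: continuousV; first by rewrite expf_neq0.
exact: exprn_continuous.
Qed.

Lemma C1_atV w p : w p != 0 -> C1_at w p -> C1_at (fun q => (w q)^-1) p.
Proof. by move=> w0; apply: C1_at_comp; exact: C1R_inv. Qed.

Lemma C1_at_comp2 w (r : pt -> pt) p : C1_at w (r p) ->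
  C1_at (fun q => r q 0 0) p -> C1_at (fun q => r q 0 1) p ->
  C1_at (fun q => w (r q)) p.
Proof.
move=> Hw Hu Hv.
have cr : \forall q \near p, cont_at r q.
  apply: filterS2 (C1_at_near_cont Hu) (C1_at_near_cont Hv) => q c0 c1.
  by apply/continuous_rowP; apply: ord2P.
have Hwr : \forall q \near p, [/\ differentiable w (r q),
    cont_at (dx w) (r q) & cont_at (dy w) (r q)].
  exact: (nbhs_singleton cr _ Hw).
apply: (@C1_atI _
  (fun q => dx w (r q) * dx (fun q => r q 0 0) q
          + dy w (r q) * dx (fun q => r q 0 1) q)
  (fun q => dx w (r q) * dy (fun q => r q 0 0) q
          + dy w (r q) * dy (fun q => r q 0 1) q)).
- apply: filterS3 Hwr Hu Hv => q [dw _ _] [du _ _] [dv _ _].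
  exact: (partials_comp2 (partials_diff dw) (partials_diff du) (partials_diff dv)).
- apply: filterS2 (filterI cr Hwr) (filterI Hu Hv).
  move=> q [c [_ cwx cwy]] [[_ ux _] [_ vx _]].
  apply: contD; apply: contM; [exact: (cont_comp c cwx)|exact: ux|
    exact: (cont_comp c cwy)|exact: vx].
- apply: filterS2 (filterI cr Hwr) (filterI Hu Hv).
  move=> q [c [_ cwx cwy]] [[_ _ uy] [_ _ vy]].
  apply: contD; apply: contM; [exact: (cont_comp c cwx)|exact: uy|
    exact: (cont_comp c cwy)|exact: vy].
Qed.

Lemma C1_onP (D : set pt) w : open D ->
  C1_on D w <-> forall p, D p -> C1_at w p.
Proof.
move=> oD; split=> [[dw cx cy] p Dp|H].
  have : \forall q \near p, D q by exact: open_nbhs_nbhs.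
  by apply: filterS => q Dq; split; [exact: dw|exact: cx|exact: cy].
by split=> p /H/nbhs_singleton[d cx cy]; [exact: d|exact: cx|exact: cy].
Qed.

Lemma C1_on_rowP (D : set pt) n (g : pt -> 'rV[R]_n) : open D ->
  C1_on D g <-> forall k, C1_on D (fun q => g q 0 k).
Proof.
move=> oD; split=> [[dg cx cy] k|H].
  have nD p : D p -> \forall q \near p, D q by move=> Dp; exact: open_nbhs_nbhs.
  split=> p Dp.
  - by move/differentiable_rowP : (dg _ Dp); apply.
  - have /continuous_rowP/(_ k) := cx _ Dp; apply: cont_near.
    by apply: filterS (nD _ Dp) => q Dq; rewrite /dx derive_row //; exact: dg.
  - have /continuous_rowP/(_ k) := cy _ Dp; apply: cont_near.
    by apply: filterS (nD _ Dp) => q Dq; rewrite /dy derive_row //; exact: dg.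
have nD p : D p -> \forall q \near p, D q by move=> Dp; exact: open_nbhs_nbhs.
have dg p : D p -> differentiable g p.
  by move=> Dp; apply/differentiable_rowP => k; case: (H k) => /(_ _ Dp).
split => // p Dp; apply/continuous_rowP => k.
- case: (H k) => _ /(_ _ Dp) cx _; move: cx; apply: cont_near.
  by apply: filterS (nD _ Dp) => q Dq; rewrite /dx derive_row //; exact: dg.
- case: (H k) => _ _ /(_ _ Dp); apply: cont_near.
  by apply: filterS (nD _ Dp) => q Dq; rewrite /dy derive_row //; exact: dg.
Qed.
End C1At.

Section C1Grad.
Variables (R : realType).
Notation pt := 'rV[R]_2.
Variables (fx fy : 'I_3 -> pt -> R).
Implicit Types (p q h : pt) (w : pt -> R).

Definition dot3 (V : 'I_3 -> pt -> R) (g : 'I_3 -> pt -> R) q :=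
  \sum_(k < 3) V k q * g k q.

(** [V] plays the role of the gradient of [w] in 3-space, and is determined
    by [w] only up to a multiple of the normal. When [fx] and [fy] are the
    partial derivatives of an immersion with C1 normal, these [w] are the
    functions that are C2 in the graph coordinates of the surface. *)
Definition C1grad w p := exists V : 'I_3 -> pt -> R,
  (forall k, C1_at (V k) p) /\
  \forall q \near p, partials w q (dot3 V fx q) (dot3 V fy q).

Lemma C1grad_diff w p : C1grad w p -> differentiable w p.
Proof. by move=> [V [_ /nbhs_singleton[]]]. Qed.

Definition fcont p := \forall q \near p, forall k,
  cont_at (fx k) q /\ cont_at (fy k) q.

Lemma C1grad_C1 w p : fcont p -> C1grad w p -> C1_at w p.
Proof.
move=> cf [V [CV H]].
have CV' : \forall q \near p, forall k, cont_at (V k) q.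
  apply: (@filter_forall _ _ (fun k q => cont_at (V k) q) (nbhs p)) => k.
  exact: (C1_at_near_cont (CV k)).
apply: (C1_atI H).
- apply: filterS2 cf CV' => q Hf HV; apply: cont_sum => k; apply: contM.
    exact: HV.
  exact: (Hf k).1.
- apply: filterS2 cf CV' => q Hf HV; apply: cont_sum => k; apply: contM.
    exact: HV.
  exact: (Hf k).2.
Qed.

Lemma C1grad_eq w w' p : (\forall q \near p, w q = w' q) ->
  C1grad w p -> C1grad w' p.
Proof.
move=> /near_join E [V [CV H]]; exists V; split => //.
by apply: filterS2 E H => q E; exact: partials_near.
Qed.

Lemma C1grad_cst c p : C1grad (fun=> c) p.
Proof.
exists (fun _ _ => 0); split; first by move=> k; exact: C1_at_cst.
by near=> q; rewrite /dot3 !big1; [exact: partials_cst| |] => k _; rewrite mul0r.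
Unshelve. all: by end_near. Qed.

Lemma C1gradD w1 w2 p : C1grad w1 p -> C1grad w2 p ->
  C1grad (fun q => w1 q + w2 q) p.
Proof.
move=> [V1 [C1 H1]] [V2 [C2 H2]]; exists (fun k q => V1 k q + V2 k q).
split; first by move=> k; exact: (C1_atD (C1 k) (C2 k)).
apply: filterS2 H1 H2 => q H1 H2; apply: partials_eq (partialsD H1 H2) _ _.
- by rewrite /dot3 -big_split; apply: eq_bigr => k _ /=; rewrite mulrDl.
- by rewrite /dot3 -big_split; apply: eq_bigr => k _ /=; rewrite mulrDl.
Qed.

Lemma C1gradM w1 w2 p : C1_at w1 p -> C1_at w2 p ->
  C1grad w1 p -> C1grad w2 p -> C1grad (fun q => w1 q * w2 q) p.
Proof.
move=> c1 c2 [V1 [C1 H1]] [V2 [C2 H2]].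
exists (fun k q => w1 q * V2 k q + w2 q * V1 k q).
split; first by move=> k; exact: (C1_atD (C1_atM c1 (C2 k)) (C1_atM c2 (C1 k))).
apply: filterS2 H1 H2 => q H1 H2; apply: partials_eq (partialsM H1 H2) _ _.
- rewrite /dot3 !mulr_sumr -big_split; apply: eq_bigr => k _ /=.
  by rewrite mulrDl !mulrA.
- rewrite /dot3 !mulr_sumr -big_split; apply: eq_bigr => k _ /=.
  by rewrite mulrDl !mulrA.
Qed.

Lemma C1grad_comp s s' s'' w p : C1R s s' (w p) -> C1R s' s'' (w p) ->
  C1_at w p -> C1grad w p -> C1grad (fun q => s (w q)) p.
Proof.
move=> Hs Hs' c [V [CV H]]; exists (fun k q => s' (w q) * V k q).
split; first by move=> k; exact: (C1_atM (C1_at_comp Hs' c) (CV k)).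
have Hsw := cont_near_pull (C1_at_cont c) Hs.
apply: filterS2 H Hsw => q H [Hd _]; apply: partials_eq (partials_comp Hd H) _ _.
- by rewrite /dot3 !mulr_sumr; apply: eq_bigr => k _; rewrite mulrA.
- by rewrite /dot3 !mulr_sumr; apply: eq_bigr => k _; rewrite mulrA.
Qed.

Lemma C1grad_affine (f : 'I_3 -> pt -> R) (v : 'I_3 -> R) c p :
  (\forall q \near p, forall k, partials (f k) q (fx k q) (fy k q)) ->
  C1grad (fun q => c + \sum_(k < 3) v k * f k q) p.
Proof.
move=> H; exists (fun k _ => v k); split; first by move=> k; exact: C1_at_cst.
apply: filterS H => q H.
have E k : partials (fun r => v k * f k r) q (v k * fx k q) (v k * fy k q).
  by apply: partials_eq (partialsM (partials_cst (v k) q) (H k)) _ _; rewrite mulr0 addr0.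
by apply: partials_eq (partialsD (partials_cst c q) (partials_sum E)) _ _; rewrite add0r.
Qed.
End C1Grad.

(** * A C2 step function on the line *)

Section Step.
Variable R : realType.
Implicit Types (s t x y : R).

Definition pos_part t : R := Num.max 0 t.

Lemma pos_partP t : pos_part t = if 0 <= t then t else 0.
Proof. by rewrite /pos_part; case: (lerP 0 t). Qed.

Lemma pos_part_le0 t : t <= 0 -> pos_part t = 0.
Proof. by move=> t0; rewrite /pos_part max_l. Qed.

Lemma pos_part_ge0 t : 0 <= t -> pos_part t = t.
Proof. by move=> t0; rewrite /pos_part max_r. Qed.

Lemma pos_part_cont t : cont_at pos_part t.
Proof.
have -> : pos_part = (fun y => (y + `|y|) / 2).
  apply/funext => y; rewrite pos_partP; case: (lerP 0 y) => y0.
    by rewrite ger0_norm //; field.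
  by rewrite ltr0_norm // subrr mul0r.
apply: contM; last exact: cont_cst.
by apply: contD; [exact: cvg_id|exact: norm_continuous].
Qed.

Lemma is_derive_pos_part2 t :
  is_derive (t : R) (1 : R) (fun y => pos_part y ^+ 2) (2 * pos_part t).
Proof.
have [t0|t0|->] := ltrgtP t 0.
- have -> : pos_part t = 0 by rewrite pos_partP leNgt t0.
  rewrite mulr0; apply: (near_eq_is_derive _ (is_derive_cst (0 : R) t 1)).
  have := lt_nbhsl t0; apply: filterS => y y0.
  by rewrite pos_partP leNgt y0 /= expr0n.
- have -> : pos_part t = t by rewrite pos_partP ltW.
  apply: (@near_eq_is_derive _ _ _ (fun y => y ^+ 2)).
    have := lt_nbhsr t0; apply: filterS => y y0.
    by rewrite pos_partP ltW.
  have := is_deriveX 2 (is_derive_id t (1 : R)).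
  by rewrite exprfctE expr1 /GRing.scale /= mulr1.
- apply/is_derive1_caratheodory; exists pos_part; split.
  + move=> y; rewrite !pos_partP lexx subr0 expr0n /= subr0.
    by case: ifP => _; rewrite ?expr2 ?mul0r.
  + exact: pos_part_cont.
  + by rewrite pos_partP lexx mulr0.
Qed.

Lemma is_derive_pos_part3 t :
  is_derive (t : R) (1 : R) (fun y => pos_part y ^+ 3) (3 * pos_part t ^+ 2).
Proof.
have -> : (fun y => pos_part y ^+ 3) = (fun y => y * pos_part y ^+ 2).
  apply/funext => y; rewrite pos_partP; case: ifP => _; first by rewrite exprS.
  by rewrite !expr0n mulr0.
have := is_deriveM (is_derive_id t (1 : R)) (is_derive_pos_part2 t).
rewrite /GRing.scale /= mulr1.
have -> : t * (2 * pos_part t) + pos_part t ^+ 2 = 3 * pos_part t ^+ 2.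
  by rewrite pos_partP; case: ifP => _; ring.
by [].
Qed.

(** The third difference of the truncated powers: applied to the truncated
    cubes it gives the integral of the quadratic B-spline, up to the factor
    6. *)
Definition bspline (g : R -> R) s : R :=
  g s - 3 * g (s - 1) + 3 * g (s - 2) - g (s - 3).

(** Normalized so that the step is 0 up to 1/4 and 1 from 3/4 on. The
    margins of width 1/4 absorb the error made when the level of a ladder
    is replaced by an approximation of it. *)
Definition step t := 6^-1 * bspline (fun y => pos_part y ^+ 3) (6 * t - 3 / 2).
Definition step' t := bspline (fun y => 3 * pos_part y ^+ 2) (6 * t - 3 / 2).
Definition step'' t := 6 * bspline (fun y => 3 * (2 * pos_part y)) (6 * t - 3 / 2).

Lemma is_derive_affine (g g' : R -> R) (a b : R) t :
  is_derive (a * t - b) (1 : R) g (g' (a * t - b)) ->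
  is_derive (t : R) (1 : R) (fun y => g (a * y - b)) (a * g' (a * t - b)).
Proof.
move=> H.
have D : is_derive t (1 : R) (fun y => a * y - b) a.
  have := is_deriveB (is_deriveZ a (is_derive_id t (1 : R))) (is_derive_cst b t 1).
  by rewrite subr0 /GRing.scale /= mulr1.
have := @is_derive1_comp _ g (fun y => a * y - b) t _ _ H D.
by rewrite mulrC.
Qed.

Lemma is_derive_bspline (g g' : R -> R) :
  (forall t, is_derive (t : R) (1 : R) g (g' t)) -> forall t,
  is_derive (t : R) (1 : R) (fun y => bspline g (6 * y - 3 / 2))
    (6 * bspline g' (6 * t - 3 / 2)).
Proof.
move=> H t.
have S b : is_derive (t : R) (1 : R) (fun y => g (6 * y - 3 / 2 - b))
    (6 * g' (6 * t - 3 / 2 - b)).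
  have -> : (fun y => g (6 * y - 3 / 2 - b)) = (fun y => g (6 * y - (3 / 2 + b))).
    by apply/funext => y; congr g; ring.
  have -> : 6 * t - 3 / 2 - b = 6 * t - (3 / 2 + b) by ring.
  exact: is_derive_affine.
have := is_deriveB (is_deriveD (is_deriveB (@is_derive_affine _ g' 6 (3 / 2) t (H _))
  (is_deriveZ 3 (S 1))) (is_deriveZ 3 (S 2))) (S 3).
rewrite /GRing.scale /=.
have -> : 6 * g' (6 * t - 3 / 2) - 3 * (6 * g' (6 * t - 3 / 2 - 1)) +
     3 * (6 * g' (6 * t - 3 / 2 - 2)) - 6 * g' (6 * t - 3 / 2 - 3)
  = 6 * bspline g' (6 * t - 3 / 2) by rewrite /bspline; ring.
by [].
Qed.

Lemma is_derive_step t : is_derive (t : R) (1 : R) step (step' t).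
Proof.
have := is_deriveZ 6^-1 (is_derive_bspline is_derive_pos_part3 t).
by rewrite /GRing.scale /= mulrA mulVf ?mul1r // pnatr_eq0.
Qed.

Lemma is_derive_step' t : is_derive (t : R) (1 : R) step' (step'' t).
Proof.
apply: (@is_derive_bspline _ (fun y => 3 * (2 * pos_part y))) => y.
exact: (is_deriveZ 3 (is_derive_pos_part2 y)).
Qed.

Lemma step''_cont t : cont_at step'' t.
Proof.
have H b : cont_at (fun t => 3 * (2 * pos_part (6 * t - 3 / 2 - b))) t.
  apply: contM; first exact: cont_cst.
  apply: contM; first exact: cont_cst.
  apply: (cont_comp (s := fun t => 6 * t - 3 / 2 - b) (t := pos_part)); last exact: pos_part_cont.
  apply: contB; last exact: cont_cst.
  apply: contB; last exact: cont_cst.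
  by apply: contM; [exact: cont_cst|exact: cvg_id].
apply: contM; first exact: cont_cst.
apply: contB; last exact: H.
apply: contD; last by apply: contM; [exact: cont_cst|exact: H].
apply: contB; last by apply: contM; [exact: cont_cst|exact: H].
have := H 0; apply: cont_near; near=> y.
by rewrite subr0.
Unshelve. all: by end_near. Qed.

Lemma C1R_step t : C1R step step' t.
Proof.
near=> y; split; first exact: is_derive_step.
apply: differentiable_continuous; apply/derivable1_diffP.
by case: (is_derive_step' y).
Unshelve. all: by end_near. Qed.

Lemma C1R_step' t : C1R step' step'' t.
Proof.
near=> y; split; first exact: is_derive_step'.
exact: step''_cont.
Unshelve. all: by end_near. Qed.

Lemma step_eq0 t : t <= 1 / 4 -> step t = 0.
Proof.
move=> t4; rewrite /step /bspline !pos_part_le0; try lra.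
Qed.

Lemma step_eq1 t : 3 / 4 <= t -> step t = 1.
Proof.
move=> t4; rewrite /step /bspline !pos_part_ge0; try lra.
Qed.

Lemma step_bounds t : `|step t| <= 1 /\ `|step' t| <= 6.
Proof.
rewrite /step /step' /bspline; move: (6 * t - 3 / 2) => s.
rewrite !ler_norml.
have [s0|s0] := lerP s 0.
  rewrite !pos_part_le0; try lra.
have [s1|s1] := lerP s 1.
  rewrite (pos_part_ge0 (ltW s0)) !pos_part_le0; try lra.
  have -> : 6^-1 * (s ^+ 3 - 3 * 0 ^+ 3 + 3 * 0 ^+ 3 - 0 ^+ 3) = s ^+ 3 / 6.
    by field.
  have -> : 3 * s ^+ 2 - 3 * (3 * 0 ^+ 2) + 3 * (3 * 0 ^+ 2) - 3 * 0 ^+ 2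
    = 3 * s ^+ 2 by ring.
  have s2 : 0 <= s ^+ 2 <= 1 by rewrite expr2; nra.
  have s3 : 0 <= s ^+ 3 <= 1 by rewrite exprS; nra.
  by lra.
pose u := s - 1.
have [s2|s2] := lerP s 2.
  rewrite (pos_part_ge0 (ltW s0)) (@pos_part_ge0 (s - 1)) ?(@pos_part_le0 (s - 2))
    ?(@pos_part_le0 (s - 3)); try lra.
  have -> : 6^-1 * (s ^+ 3 - 3 * (s - 1) ^+ 3 + 3 * 0 ^+ 3 - 0 ^+ 3)
    = (1 + 3 * u + 3 * u ^+ 2 - 2 * u ^+ 3) / 6 by rewrite /u; field.
  have -> : 3 * s ^+ 2 - 3 * (3 * (s - 1) ^+ 2) + 3 * (3 * 0 ^+ 2) - 3 * 0 ^+ 2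
    = 3 * (1 + 2 * u - 2 * u ^+ 2) by rewrite /u; ring.
  have u2 : 0 <= u ^+ 2 <= u by rewrite expr2 /u; nra.
  have u3 : 0 <= u ^+ 3 <= u ^+ 2.
    rewrite exprS; move: u2; rewrite expr2 /u => u2; nra.
  have u1 : 0 <= u <= 1 by rewrite /u; lra.
  (* This product bounds the step, and the square below its derivative. *)
  have : 0 <= (1 - u) ^+ 2 * (1 + 2 * u) by rewrite mulr_ge0 ?sqr_ge0 //; lra.
  have -> : (1 - u) ^+ 2 * (1 + 2 * u) = 1 - 3 * u ^+ 2 + 2 * u ^+ 3 by ring.
  have : 0 <= (1 - 2 * u) ^+ 2 by rewrite sqr_ge0.
  have -> : (1 - 2 * u) ^+ 2 = 1 - 4 * u + 4 * u ^+ 2 by ring.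
  by lra.
have [s3|s3] := lerP s 3.
  rewrite (pos_part_ge0 (ltW s0)) (@pos_part_ge0 (s - 1)) ?(@pos_part_ge0 (s - 2))
    ?(@pos_part_le0 (s - 3)); try lra.
  have -> : 6^-1 * (s ^+ 3 - 3 * (s - 1) ^+ 3 + 3 * (s - 2) ^+ 3 - 0 ^+ 3)
    = 1 - (3 - s) ^+ 3 / 6 by field.
  have -> : 3 * s ^+ 2 - 3 * (3 * (s - 1) ^+ 2) + 3 * (3 * (s - 2) ^+ 2) - 3 * 0 ^+ 2
    = 3 * (3 - s) ^+ 2 by ring.
  have v2 : 0 <= (3 - s) ^+ 2 <= 1 by rewrite expr2; nra.
  have v3 : 0 <= (3 - s) ^+ 3 <= 1 by rewrite exprS; nra.
  by lra.
rewrite !pos_part_ge0; try lra.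
Qed.
End Step.

(** * Gluing approximations along a ladder of levels *)

Section Ladder.
Variables (R : realType).
Notation pt := 'rV[R]_2.
Variables (fx fy : 'I_3 -> pt -> R).
Implicit Types (p q : pt) (w : pt -> R) (tau : pt -> R) (T : int -> pt -> R).

Definition blend w0 w1 (t : pt -> R) : pt -> R :=
  fun q => w0 q + step (t q) * (w1 q - w0 q).

(** The member of index [n] is used near the level [tau = n] and the next
    one near [tau = n + 1]. The transition is driven by [T n], a function
    with C1 gradient close to [tau], because [tau] itself need not have
    one. *)
Definition ladder tau T (w : int -> pt -> R) : pt -> R := fun q =>
  let n := Num.floor (tau q) in
  blend (w n) (w (n + 1)) (fun r => T n r - n%:~R) q.

(** The integer part of [tau] jumps at the integer levels, but around such
    a level both adjacent formulas reduce to the same member of the family,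
    because the step is locally constant there. Hence one blend represents
    the ladder on a whole neighbourhood. *)
Lemma ladder_near tau T (w : int -> pt -> R) p :
  cont_at tau p ->
  (\forall q \near p, forall i : int, `|tau q - i%:~R| < 2 ->
     `|T i q - tau q| <= 1 / 8) ->
  let n := Num.floor (tau p) in
  \forall q \near p,
    blend (w n) (w (n + 1)) (fun r => T n r - n%:~R) q = ladder tau T w q.
Proof.
move=> ct HT n.
have /andP[np pn] := floor_itv (tau p); rewrite -/n intrD in np pn.
have H1 : \forall q \near p, n%:~R - 1 / 8 < tau q.
  by apply: (cont_near_pull (P := fun y => n%:~R - 1 / 8 < y) ct); apply: lt_nbhsr; lra.
have H2 : \forall q \near p, tau q < n%:~R + 9 / 8.
  by apply: (cont_near_pull (P := fun y => y < n%:~R + 9 / 8) ct); apply: lt_nbhsl; lra.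
apply: filterS3 H1 H2 HT => q q1 q2 HT.
rewrite /ladder; set k := Num.floor (tau q).
have /andP[kq qk] := floor_itv (tau q); rewrite -/k intrD in kq qk.
have : k = n - 1 \/ k = n \/ k = n + 1.
  have k1 : n - 2 < k by rewrite -(ltr_int R) intrB /=; lra.
  have k2 : k < n + 2 by rewrite -(ltr_int R) intrD /=; lra.
  by lia.
rewrite /blend; case => [kE|[-> //|kE]].
- have Tn : T n q - n%:~R <= 1 / 4.
    have /HT : `|tau q - n%:~R| < 2 by rewrite ltr_norml; lra.
    by rewrite ler_norml kE intrB in qk *; lra.
  have Tk : 3 / 4 <= T k q - k%:~R.
    have /HT : `|tau q - k%:~R| < 2 by rewrite ltr_norml; lra.
    by rewrite ler_norml kE intrB; lra.
  by rewrite (step_eq0 Tn) (step_eq1 Tk) kE subrK; ring.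
- have Tn : 3 / 4 <= T n q - n%:~R.
    have /HT : `|tau q - n%:~R| < 2 by rewrite ltr_norml; lra.
    by rewrite ler_norml kE intrD in kq *; lra.
  have Tk : T k q - k%:~R <= 1 / 4.
    have /HT : `|tau q - k%:~R| < 2 by rewrite ltr_norml; lra.
    by rewrite ler_norml kE intrD; lra.
  by rewrite (step_eq1 Tn) (step_eq0 Tk) kE; ring.
Qed.


Lemma C1grad_blend w0 w1 t p : fcont fx fy p -> C1grad fx fy w0 p ->
  C1grad fx fy w1 p -> C1grad fx fy t p -> C1grad fx fy (blend w0 w1 t) p.
Proof.
move=> cf H0 H1 Ht.
have Hd : C1grad fx fy (fun q => w1 q - w0 q) p.
  have := C1gradD H1 (C1gradM (C1_at_cst (-1) p) (C1grad_C1 cf H0)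
    (C1grad_cst _ _ (-1) p) H0).
  by apply: C1grad_eq; near=> q; rewrite mulN1r.
have Hs := C1grad_comp (C1R_step (t p)) (C1R_step' (t p)) (C1grad_C1 cf Ht) Ht.
exact: (C1gradD H0 (C1gradM (C1grad_C1 cf Hs) (C1grad_C1 cf Hd) Hs Hd)).
Unshelve. all: by end_near. Qed.

Definition C1close w p (g a b e eta : R) :=
  [/\ `|w p - g| <= e, `|dx w p - a| <= eta & `|dy w p - b| <= eta].

(** Differentiating the blend produces the term [step' * T' * (w1 - w0)],
    which is where the slope [L] multiplies the error [e] of the values;
    the constants come from the bounds 1 and 6 on the step and its
    derivative. *)
Lemma close_blend w0 w1 t p g a b e eta L :
  differentiable w0 p -> differentiable w1 p -> differentiable t p ->
  C1close w0 p g a b e eta -> C1close w1 p g a b e eta ->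
  `|dx t p| <= L -> `|dy t p| <= L ->
  C1close (blend w0 w1 t) p g a b (3 * e) (3 * eta + 12 * (L * e)).
Proof.
move=> D0 D1 Dt [g0 x0 y0] [g1 x1 y1] Lx Ly.
have [s0 s1] := step_bounds (t p).
have dw : `|w1 p - w0 p| <= 2 * e.
  have -> : w1 p - w0 p = (w1 p - g) - (w0 p - g) by ring.
  by rewrite mulrDl mul1r (le_trans (ler_normB _ _)) // lerD.
have e0 : 0 <= e by apply: le_trans g0.
have L0 : 0 <= L by apply: le_trans Lx.
have bnd c0 c1 dt c : `|c0 - c| <= eta -> `|c1 - c| <= eta -> `|dt| <= L ->
   `|c0 + (step (t p) * (c1 - c0) + (w1 p - w0 p) * (step' (t p) * dt)) - c|
     <= 3 * eta + 12 * (L * e).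
  move=> h0 h1 ht; move: (step (t p)) (step' (t p)) s0 s1 => s s' s0 s1.
  have -> : c0 + (s * (c1 - c0) + (w1 p - w0 p) * (s' * dt)) - c
    = (c0 - c) + (s * ((c1 - c) - (c0 - c)) + (w1 p - w0 p) * (s' * dt)).
    by ring.
  have E : 3 * eta + 12 * (L * e) = eta + (1 * (eta + eta) + (2 * e) * (6 * L)).
    by ring.
  rewrite E; apply: le_trans (ler_normD _ _) _; apply: lerD => //.
  apply: le_trans (ler_normD _ _) _; rewrite !normrM; apply: lerD.
    by apply: ler_pM => //; rewrite (le_trans (ler_normB _ _)) // lerD.
  by apply: ler_pM => //; apply: ler_pM.
have Dd : partials (fun q => w1 q - w0 q) p (dx w1 p - dx w0 p) (dy w1 p - dy w0 p).
  have := partialsD (partials_diff D1) (partialsM (partials_cst (-1) p) (partials_diff D0)).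
  move=> /partials_eq HH; apply: (partials_near _ (HH _ _ _ _)).
  - by near=> q; rewrite mulN1r.
  - by rewrite mulr0 addr0 mulN1r.
  - by rewrite mulr0 addr0 mulN1r.
have := partialsD (partials_diff D0)
  (partialsM (partials_comp (is_derive_step _) (partials_diff Dt)) Dd).
rewrite -/(blend w0 w1 t) => -[_ Dx Dy].
split; [|by rewrite Dx; exact: (bnd _ _ _ _ x0 x1 Lx)
        |by rewrite Dy; exact: (bnd _ _ _ _ y0 y1 Ly)].
have -> : blend w0 w1 t p - g = (w0 p - g) + step (t p) * (w1 p - w0 p).
  by rewrite /blend; ring.
have -> : 3 * e = e + 1 * (2 * e) by ring.
apply: le_trans (ler_normD _ _) _; apply: lerD => //.
by rewrite (normrM (step (t p))); apply: ler_pM.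
Unshelve. all: by end_near. Qed.

Lemma C1grad_ladder tau T (w : int -> pt -> R) p : fcont fx fy p -> cont_at tau p ->
  (\forall q \near p, forall i : int, `|tau q - i%:~R| < 2 ->
     `|T i q - tau q| <= 1 / 8) ->
  (forall i : int, `|tau p - i%:~R| < 2 ->
    C1grad fx fy (T i) p /\ C1grad fx fy (w i) p) ->
  C1grad fx fy (ladder tau T w) p /\
  forall g a b e eta L, let n := Num.floor (tau p) in
    C1close (w n) p g a b e eta -> C1close (w (n + 1)) p g a b e eta ->
    `|dx (T n) p| <= L -> `|dy (T n) p| <= L ->
    C1close (ladder tau T w) p g a b (3 * e) (3 * eta + 12 * (L * e)).
Proof.
move=> cf ct HT H.
have E := ladder_near w ct HT; move: E; set n := Num.floor (tau p) => /= E.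
have /andP[np pn] := floor_itv (tau p); rewrite -/n intrD in np pn.
have [Tn wn] : C1grad fx fy (T n) p /\ C1grad fx fy (w n) p.
  by apply: H; rewrite ltr_norml; lra.
have [_ wn1] : C1grad fx fy (T (n + 1)) p /\ C1grad fx fy (w (n + 1)) p.
  by apply: H; rewrite ltr_norml intrD; lra.
have Ht : C1grad fx fy (fun r => T n r - n%:~R) p.
  exact: C1gradD Tn (C1grad_cst _ _ (- n%:~R) p).
have B := C1grad_blend cf wn wn1 Ht.
split; first exact: C1grad_eq E B.
move=> g a b e eta L c0 c1 Lx Ly.
have := partialsD (partials_diff (C1grad_diff Tn)) (partials_cst (- n%:~R) p).
rewrite !addr0 => -[Dt xt yt].
have := @close_blend _ _ _ _ _ _ _ _ _ L (C1grad_diff wn) (C1grad_diff wn1) Dt c0 c1.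
rewrite xt yt => /(_ Lx Ly).
have := partials_near E (partials_diff (C1grad_diff B)).
by rewrite /C1close -(nbhs_singleton E) => -[_ -> ->].
Qed.
End Ladder.

(** * Approximating the coordinates on a compact set *)

Section MeanValue.
Variable R : realType.
Notation pt := 'rV[R]_2.
Implicit Types (p q : pt) (w : pt -> R).

Lemma is_derive_line w p v (t : R) : differentiable w (p + t *: v) ->
  is_derive t (1 : R) (fun s => w (p + s *: v))
    (v 0 0 * dx w (p + t *: v) + v 0 1 * dy w (p + t *: v)).
Proof.
move=> dw.
have dl : is_diff t (fun s : R => p + s *: v) ( *:%R^~ v).
  have := is_diffD (is_diff_cst p t) (is_diff_scalel t v).
  by rewrite add0r.
have [dl1 dl2] := dl.
have dc : differentiable (fun s : R => w (p + s *: v)) t.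
  exact: (differentiable_comp dl1 dw).
apply: DeriveDef; first exact/derivable1_diffP.
rewrite (deriveE _ dc) (diff_comp dl1 dw) /= dl2 (diff_lin2 _ dw).
by rewrite scale1r.
Qed.

(** The factor 2 comes from the norm of the plane being the sup norm: both
    partial derivatives contribute. *)
Lemma mean_value w p q (M : R) :
  (forall t, 0 <= t <= 1 -> [/\ differentiable w (p + t *: (q - p)),
     `|dx w (p + t *: (q - p))| <= M & `|dy w (p + t *: (q - p))| <= M]) ->
  `|w q - w p| <= 2 * M * `|q - p|.
Proof.
move=> H; set v := q - p in H *.
have I (t : R) : t \in `[(0:R), 1] -> is_derive t (1 : R) (fun s => w (p + s *: v))
    (v 0 0 * dx w (p + t *: v) + v 0 1 * dy w (p + t *: v)).
  by rewrite in_itv /= => /H[D _ _]; exact: is_derive_line.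
pose F (s : R) := w (p + s *: v).
pose dF (t : R) := v 0 0 * dx w (p + t *: v) + v 0 1 * dy w (p + t *: v).
have I1 (t : R) : t \in `](0 : R), 1[ -> is_derive t (1 : R) F (dF t).
  by move=> t01; apply: I; exact: subset_itv_oo_cc t01.
have cF : {within `[(0 : R), 1], continuous F}.
  by apply: derivable_within_continuous => t /I[].
have [t] := MVT_segment ler01 I1 cF.
rewrite in_itv /= => /H[_ Mx My].
have -> : F 1 = w q by rewrite /F scale1r /v addrC subrK.
have -> : F 0 = w p by rewrite /F scale0r addr0.
rewrite subr0 mulr1 => ->.
have [v0 v1] := pt_coord_le v.
have B (a b c d n : R) : `|a| <= n -> `|b| <= n -> `|c| <= M -> `|d| <= M ->
    `|a * c + b * d| <= 2 * M * n.
  move=> an bn cM dM; apply: le_trans (ler_normD _ _) _; rewrite !normrM.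
  have -> : 2 * M * n = n * M + n * M by ring.
  by apply: lerD; apply: ler_pM.
exact: (B _ _ _ _ _ v0 v1 Mx My).
Qed.

Lemma segment_dist p q c (t r : R) : 0 <= t <= 1 ->
  `|p - c| < r -> `|q - c| < r -> `|p + t *: (q - p) - c| < r.
Proof.
move=> /andP[t0 t1] pr qr.
have -> : p + t *: (q - p) - c = (1 - t) *: (p - c) + t *: (q - c).
  rewrite !scalerBr !scalerBl !scale1r.
  by apply/rowP => j; rewrite !mxE; ring.
apply: le_lt_trans (ler_normD _ _) _; rewrite !normrZ.
rewrite (ger0_norm t0) ger0_norm ?subr_ge0 //.
have [->|tn0] := eqVneq t 0; first by rewrite subr0 mul1r mul0r addr0.
have tp : 0 < t by rewrite lt_def tn0.
by nra.
Qed.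
End MeanValue.

Section Grid.
Variables (R : realType).
Notation pt := 'rV[R]_2.
Variables (D : set pt) (f fx fy Vx Vy : 'I_3 -> pt -> R).
Hypothesis oD : open D.
Hypothesis fd : forall q, D q -> forall k, partials (f k) q (fx k q) (fy k q).
Hypothesis fc : forall q, D q -> forall k, cont_at (fx k) q /\ cont_at (fy k) q.
Hypothesis Vc : forall q, D q -> forall k, cont_at (Vx k) q /\ cont_at (Vy k) q.
Hypothesis Vdual : forall q, D q ->
  [/\ dot3 Vx fx q = 1, dot3 Vx fy q = 0, dot3 Vy fx q = 0 & dot3 Vy fy q = 1].
Implicit Types (p q c : pt) (w : pt -> R).

Lemma D_near p : D p -> \forall q \near p, D q.
Proof. by move=> Dp; apply: open_nbhs_nbhs. Qed.

Lemma D_fcont p : D p -> fcont fx fy p.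
Proof. by move=> /D_near; apply: filterS => q Dq k; exact: fc. Qed.

(** When [g] is a partial derivative of [f], this is the partial derivative
    at [q] of the function [affine_at V x c]. *)
Definition pairing (V g : 'I_3 -> pt -> R) c q := \sum_(k < 3) V k c * g k q.

Lemma pairing_near (V g : 'I_3 -> pt -> R) p (eta : R) : 0 < eta ->
  (forall k, cont_at (V k) p) -> (forall k, cont_at (g k) p) ->
  exists2 d : R, 0 < d & forall c q, `|c - p| < d -> `|q - p| < d ->
    `|pairing V g c q - pairing V g p p| <= eta.
Proof.
move=> eta0 cV cg.
have C : cont_at (fun z : pt * pt => \sum_(k < 3) V k z.1 * g k z.2) (p, p).
  apply: cont_sum => k; apply: contM.
    by apply: (cont_comp (s := fst) (t := V k)); [exact: cvg_fst|exact: cV].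
  by apply: (cont_comp (s := snd) (t := g k)); [exact: cvg_snd|exact: cg].
move/cvgrPdist_le : C => /(_ _ eta0)[[A B] /= [nA nB] AB].
have [d /= d0 dAB] : exists2 d : R, 0 < d & forall c, `|c - p| < d -> A c /\ B c.
  have /nbhs_ballP[d /= d0 dAB] : nbhs p (A `&` B) by exact: filterI.
  by exists d => // c cd; apply: dAB; rewrite -ball_normE /= distrC.
exists d => // c q cd qd; rewrite distrC.
apply: (AB (c, q)); split.
- by have [] := dAB _ cd.
- by have [] := dAB _ qd.
Qed.

(** The ball of radius [4 * r] contains every grid point used at a point at
    distance less than [r] from [p]. *)
Definition dual_near (eta r : R) p := forall c q,
  `|c - p| < 4 * r -> `|q - p| < 4 * r ->
  D c /\ D q /\
  [/\ `|pairing Vx fx c q - 1| <= eta, `|pairing Vx fy c q| <= eta,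
      `|pairing Vy fx c q| <= eta & `|pairing Vy fy c q - 1| <= eta].

(** At [c = q = p] the four pairings are those of dual bases, so by
    continuity they are almost so nearby; compactness makes the radius
    uniform. *)
Lemma dual_near_uniform (K : set pt) (eta : R) : compact K -> K `<=` D -> 0 < eta ->
  exists r : R, [/\ 0 < r, r <= 1 & forall p, K p -> dual_near eta r p].
Proof.
move=> cK KD eta0.
have : \forall r \near (0 : R)^'+, K `<=` dual_near eta r.
  move/compact_near_coveringP: cK; apply => p Kp.
  have Dp := KD _ Kp; have [xx xy yx yy] := Vdual Dp.
  have cVx k := (Vc Dp k).1; have cVy k := (Vc Dp k).2.
  have cfx k := (fc Dp k).1; have cfy k := (fc Dp k).2.
  have [s1 s10 H1] := pairing_near eta0 cVx cfx.
  have [s2 s20 H2] := pairing_near eta0 cVx cfy.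
  have [s3 s30 H3] := pairing_near eta0 cVy cfx.
  have [s4 s40 H4] := pairing_near eta0 cVy cfy.
  have [s5 s50 H5] : exists2 d : R, 0 < d & forall c, `|c - p| < d -> D c.
    have /nbhs_ballP[d /= d0 Hd] := D_near Dp.
    by exists d => // c cd; apply: Hd; rewrite -ball_normE /= distrC.
  pose d := Num.min s1 (Num.min s2 (Num.min s3 (Num.min s4 s5))).
  have d0 : 0 < d by rewrite !lt_min s10 s20 s30 s40 s50.
  near=> p' r => c q cp qp.
  have p'd : `|p' - p| < d / 2.
    near: p'; apply/nbhs_ballP; exists (d / 2) => /=; first by rewrite divr_gt0.
    by move=> z; rewrite -ball_normE /= distrC.
  have rd : r < d / 8 by near: r; apply: nbhs_right_lt; rewrite divr_gt0.
  have B z : `|z - p'| < 4 * r -> `|z - p| < d.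
    move=> zp; rewrite -(subrKA p'); apply: le_lt_trans (ler_normD _ _) _.
    by lra.
  have Bc := B _ cp; have Bq := B _ qp.
  have Dz z : `|z - p| < d -> D z.
    by rewrite !lt_min => /and5P[_ _ _ _]; exact: H5.
  move: (Bc) (Bq); rewrite !lt_min => /and5P[c1 c2 c3 c4 _] /and5P[q1 q2 q3 q4 _].
  split; [exact: Dz|split; [exact: Dz|split]].
  - by have := H1 _ _ c1 q1; rewrite /pairing -/(dot3 Vx fx p) xx.
  - by have := H2 _ _ c2 q2; rewrite /pairing -/(dot3 Vx fy p) xy subr0.
  - by have := H3 _ _ c3 q3; rewrite /pairing -/(dot3 Vy fx p) yx subr0.
  - by have := H4 _ _ c4 q4; rewrite /pairing -/(dot3 Vy fy p) yy.
move=> H.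
near (0 : R)^'+ => r; exists r; split => //.
- near: r; exact: nbhs_right_ltW.
- by near: r; exact: H.
Unshelve. all: by end_near. Qed.

Definition affine_at (V : 'I_3 -> pt -> R) (x : R) c q :=
  x - \sum_(k < 3) V k c * f k c + \sum_(k < 3) V k c * f k q.

Lemma C1grad_affine_at V x c q : D q -> C1grad fx fy (affine_at V x c) q.
Proof.
move=> Dq; apply: C1grad_affine.
by apply: filterS (D_near Dq) => r Dr k; exact: fd.
Qed.

Lemma partials_affine_at V x c q : D q ->
  partials (affine_at V x c) q (pairing V fx c q) (pairing V fy c q).
Proof.
move=> Dq.
have E k : partials (fun r => V k c * f k r) q (V k c * fx k q) (V k c * fy k q).
  by apply: partials_eq (partialsM (partials_cst (V k c) q) (fd Dq k)) _ _; rewrite mulr0 addr0.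
by apply: partials_eq (partialsD (partials_cst _ q) (partials_sum E)) _ _; rewrite add0r.
Qed.

(** The derivative of the error is bounded by [eta] on the ball and the
    error vanishes at [c], so the mean value inequality makes it of order
    [eta * r]. *)
Lemma close_affine_at V (g : pt -> R) (a b eta r : R) p c q :
  (forall z, partials g z a b) ->
  (forall z, `|z - p| < 4 * r ->
    [/\ D z, `|pairing V fx c z - a| <= eta & `|pairing V fy c z - b| <= eta]) ->
  `|c - p| < 4 * r -> `|q - p| < 4 * r -> `|q - c| <= 2 * r ->
  C1close (affine_at V (g c) c) q (g q) a b (4 * eta * r) eta.
Proof.
move=> dg H cp qp qc.
have [Dq hx hy] := H _ qp.
have [_ ex ey] := partials_affine_at V (g c) c Dq.
split; rewrite ?ex ?ey //.
have eta0 : 0 <= eta by apply: le_trans hx.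
pose w z := affine_at V (g c) c z + (-1) * g z.
have dw z : `|z - p| < 4 * r ->
    partials w z (pairing V fx c z - a) (pairing V fy c z - b).
  move=> /H[Dz _ _].
  apply: partials_eq (partialsD (partials_affine_at V (g c) c Dz)
    (partialsM (partials_cst (-1) z) (dg z))) _ _.
  - by rewrite mulr0 addr0 mulN1r.
  - by rewrite mulr0 addr0 mulN1r.
have wc : w c = 0 by rewrite /w /affine_at subrK mulN1r subrr.
have wq : w q = affine_at V (g c) c q - g q by rewrite /w mulN1r.
rewrite -wq -[w q]subr0 -wc.
apply: le_trans (_ : 2 * eta * `|q - c| <= _).
  apply: mean_value => t t01.
  have zp := segment_dist t01 cp qp.
  have [dz -> ->] := dw _ zp.
  by have [_ zx zy] := H _ zp.
have -> : 4 * eta * r = 2 * eta * (2 * r) by ring.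
by apply: ler_wpM2l => //; rewrite mulr_ge0.
Qed.

(** Here the level is a coordinate divided by the mesh [r] and the slope of
    the transition is at most [2 / r], hence the term [e / r]. *)
Lemma coord_ladder (m : 'I_2) (r : R) (a : int -> pt -> R) p :
  fcont fx fy p -> 0 < r ->
  (\forall q \near p, forall i : int, `|(q : pt) 0 m / r - i%:~R| < 2 ->
     `|a i q - q 0 m| <= r / 8) ->
  (forall i : int, `|p 0 m / r - i%:~R| < 2 ->
     [/\ C1grad fx fy (a i) p, `|dx (a i) p| <= 2 & `|dy (a i) p| <= 2]) ->
  forall w : int -> pt -> R,
  (forall i : int, `|p 0 m / r - i%:~R| < 2 -> C1grad fx fy (w i) p) ->
  let W := ladder (fun q : pt => q 0 m / r) (fun i q => r^-1 * a i q) w in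
  C1grad fx fy W p /\
  forall g a b e eta,
    (forall i : int, `|p 0 m / r - i%:~R| < 2 -> C1close (w i) p g a b e eta) ->
    C1close W p g a b (3 * e) (3 * eta + 24 * (e / r)).
Proof.
move=> cf r0 Ha Hap w Hw W.
have ct : cont_at (fun q : pt => q 0 m / r) p.
  by apply: contM; [exact: coord_continuous|exact: cont_cst].
have [] := @C1grad_ladder _ fx fy _ (fun i q => r^-1 * a i q) w p cf ct.
- apply: filterS Ha => q Ha i /Ha.
  have -> : r^-1 * a i q - q 0 m / r = r^-1 * (a i q - q 0 m) by ring.
  rewrite normrM ger0_norm ?invr_ge0 ?(ltW r0) // => h.
  by rewrite ler_pdivrMl //; lra.
- move=> i hi; split; last exact: Hw.
  have [ga _ _] := Hap i hi.
  exact: (C1gradM (C1_at_cst _ p) (C1grad_C1 cf ga) (C1grad_cst _ _ _ p) ga).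
move=> H1 H2; split => // g a' b e eta Hc.
have /andP[np pn] := floor_itv (p 0 m / r); set n := Num.floor _ in np pn.
have hn : `|p 0 m / r - n%:~R| < 2.
  by rewrite ltr_norml; rewrite intrD in pn; lra.
have hn1 : `|p 0 m / r - (n + 1)%:~R| < 2.
  by rewrite ltr_norml; rewrite intrD in pn *; lra.
have scale t : `|t| <= 2 -> r^-1 * `|t| <= 2 / r.
  by move=> t2; rewrite mulrC ler_pM2r ?invr_gt0.
have [ga ax ay] := Hap n hn.
have := partialsM (partials_cst (r^-1) p) (partials_diff (C1grad_diff ga)).
rewrite !mulr0 !addr0 => -[_ Ex Ey].
have := H2 g a' b e eta (2 / r) (Hc _ hn) (Hc _ hn1).
rewrite -/n Ex Ey !normrM ger0_norm ?invr_ge0 ?(ltW r0) // => /(_ _ _)H3.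
have -> : 24 * (e / r) = 12 * (2 / r * e) by ring.
by apply: H3; exact: scale.
Qed.

(** A pass of [coord_ladder] along each axis. The affine approximations
    have errors [4 * h * r] and [h]; the first pass turns them into [12 * h
    * r] and [99 * h], the second one into [36 * h * r] and [585 * h]. *)
Lemma local_approx (K : set pt) (eta : R) : compact K -> K `<=` D -> 0 < eta ->
  exists u v : pt -> R, forall p, K p ->
  [/\ C1grad fx fy u p, C1grad fx fy v p,
      C1close u p (p 0 0) 1 0 eta eta & C1close v p (p 0 1) 0 1 eta eta].
Proof.
move=> cK KD eta0.
(* 1000 exceeds the constant 585 of the second pass, and keeps the error of
   the approximate levels below the tolerance of the ladders. *)
pose h := Num.min eta 1 / 1000.
have m0 : 0 < Num.min eta 1 by rewrite lt_min eta0 ltr01.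
have m1 : Num.min eta 1 <= eta by rewrite ge_min lexx.
have m2 : Num.min eta 1 <= 1 by rewrite ge_min lexx orbT.
have [h0 he h1] : [/\ 0 < h, 1000 * h <= eta & 1000 * h <= 1].
  by rewrite /h; split; lra.
move: h h0 he h1 {m0 m1 m2} => h h0 he h1.
have h_le1 : h <= 1 by lra.
have h99 : 99 * h <= 1 by lra.
have h12 : 12 * h <= 1 / 8 by lra.
have h36 : 36 * h <= eta by lra.
have h585 : 585 * h <= eta by lra.
have n0 : `|0 : R| <= 1 by rewrite normr0.
have n1 : `|1 : R| <= 1 by rewrite normr1.
have [r [r0 r1 Hr]] := dual_near_uniform cK KD h0.
pose c (i j : int) : pt := (r * i%:~R) *: e_x R + (r * j%:~R) *: e_y R.
have c_x i j : c i j 0 0 = r * i%:~R by rewrite /c !mxE /= mulr1 mulr0 addr0.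
have c_y i j : c i j 0 1 = r * j%:~R by rewrite /c !mxE /= mulr1 mulr0 add0r.
pose U := [set q : pt | exists2 p, K p & `|q - p| < r].
have KU p : K p -> \forall q \near p, U q.
  move=> Kp; apply/nbhs_ballP; exists r => //= q; rewrite -ball_normE /= => pq.
  by exists p => //; rewrite distrC.
have UD q : U q -> D q.
  move=> [p Kp qp]; have [] := Hr p Kp q q _ _ => //; lra.
pose A i j := affine_at Vx (c i j 0 0) (c i j).
pose B i j := affine_at Vy (c i j 0 1) (c i j).
have near_c i j q : `|q 0 0 / r - i%:~R| < 2 -> `|q 0 1 / r - j%:~R| < 2 ->
    `|q - c i j| < 2 * r.
  move=> hi hj; rewrite pt_norm_lt ?mulr_gt0 //.
  rewrite [(q - c i j) 0 0]mxE [(q - c i j) 0 1]mxE ![(- c i j) 0 _]mxE c_x c_y.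
  have E (x y : R) : `|x / r - y| < 2 -> `|x - r * y| < 2 * r.
    have -> : x / r - y = (x - r * y) / r by field; rewrite gt_eqF.
    by rewrite normrM normfV (gtr0_norm r0) ltr_pdivrMr.
  by rewrite !E.
have AB i j q : U q -> `|q 0 0 / r - i%:~R| < 2 -> `|q 0 1 / r - j%:~R| < 2 ->
    C1close (A i j) q (q 0 0) 1 0 (4 * h * r) h /\
    C1close (B i j) q (q 0 1) 0 1 (4 * h * r) h.
  move=> [p Kp qp] hi hj.
  have qc := near_c _ _ _ hi hj.
  have qp4 : `|q - p| < 4 * r by lra.
  have cp : `|c i j - p| < 4 * r.
    rewrite -(subrKA q); apply: le_lt_trans (ler_normD _ _) _.
    by rewrite distrC in qc; lra.
  split.
  - apply: (@close_affine_at Vx (fun q => q 0 0) 1 0 h r p _ _ (@partials_x R)) => //.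
      move=> z zp; have [_ [Dz [? ? _ _]]] := Hr p Kp _ _ cp zp.
      by rewrite subr0.
    exact: ltW.
  - apply: (@close_affine_at Vy (fun q => q 0 1) 0 1 h r p _ _ (@partials_y R)) => //.
      move=> z zp; have [_ [Dz [_ _ ? ?]]] := Hr p Kp _ _ cp zp.
      by rewrite subr0.
    exact: ltW.
have hr m : 0 <= m -> m <= 12 -> m * h * r <= r / 8.
  move=> m0 m12; have -> : r / 8 = (1 / 8) * r by ring.
  by rewrite ler_wpM2r ?(ltW r0) // (le_trans (ler_wpM2r (ltW h0) m12)).
have bnd (a b e et g : R) w p : C1close w p g a b e et -> `|a| <= 1 -> `|b| <= 1 ->
    et <= 1 -> `|dx w p| <= 2 /\ `|dy w p| <= 2.
  move=> [_ hx hy] ha hb het; split.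
  - rewrite -(subrK a (dx w p)); apply: le_trans (ler_normD _ _) _; lra.
  - rewrite -(subrK b (dy w p)); apply: le_trans (ler_normD _ _) _; lra.
have Unear q : U q -> \forall q' \near q, U q'.
  move=> [p Kp qp]; apply/nbhs_ballP; exists (r - `|q - p|).
    by rewrite /= subr_gt0.
  move=> z; rewrite -ball_normE /= => zq; exists p => //.
  rewrite -(subrKA q); apply: le_lt_trans (ler_normD _ _) _.
  by rewrite distrC in zq; lra.
have Jnear j q : `|q 0 1 / r - j%:~R| < 2 ->
    \forall q' \near q, `|(q' : pt) 0 1 / r - j%:~R| < 2.
  move=> qj.
  have ct : cont_at (fun q : pt => `|q 0 1 / r - j%:~R|) q.
    apply: (cont_comp (s := fun q : pt => q 0 1 / r - j%:~R) (t := Num.norm)).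
      apply: contB; last exact: cont_cst.
      by apply: contM; [exact: coord_continuous|exact: cont_cst].
    exact: norm_continuous.
  exact: (cont_near_pull (P := fun y => y < 2) ct (lt_nbhsl qj)).
pose X j (w : int -> pt -> R) := ladder (fun q : pt => q 0 0 / r) (fun i q => r^-1 * A i j q) w.
have hX j q (w : int -> pt -> R) : U q -> `|q 0 1 / r - j%:~R| < 2 ->
    (forall i : int, `|q 0 0 / r - i%:~R| < 2 -> C1grad fx fy (w i) q) ->
    C1grad fx fy (X j w) q /\
    forall g a b e et,
      (forall i : int, `|q 0 0 / r - i%:~R| < 2 -> C1close (w i) q g a b e et) ->
      C1close (X j w) q g a b (3 * e) (3 * et + 24 * (e / r)).
  move=> Uq qj; have Dq := UD _ Uq.
  apply: coord_ladder => //; first exact: D_fcont.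
  - apply: filterS2 (Unear _ Uq) (Jnear _ _ qj) => q' Uq' q'j i hi.
    have [[+ _ _] _] := AB i j q' Uq' hi q'j.
    by move=> /le_trans; apply; apply: hr; rewrite ?ler_nat.
  - move=> i hi; have [cA _] := AB i j q Uq hi qj.
    have [b1 b2] := bnd _ _ _ _ _ _ _ cA n1 n0 h_le1.
    by split; [exact: (C1grad_affine_at _ _ _ Dq)|exact: b1|exact: b2].
pose Hu j := X j (fun i => A i j).
pose Hv j := X j (fun i => B i j).
have r_neq0 : r != 0 by rewrite gt_eqF.
have hH j q : U q -> `|q 0 1 / r - j%:~R| < 2 ->
    [/\ C1grad fx fy (Hu j) q, C1grad fx fy (Hv j) q,
        C1close (Hu j) q (q 0 0) 1 0 (12 * h * r) (99 * h) &
        C1close (Hv j) q (q 0 1) 0 1 (12 * h * r) (99 * h)].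
  move=> Uq qj; have Dq := UD _ Uq.
  have [g1 c1] := hX j q (fun i => A i j) Uq qj
    (fun i _ => C1grad_affine_at _ _ _ Dq).
  have [g2 c2] := hX j q (fun i => B i j) Uq qj
    (fun i _ => C1grad_affine_at _ _ _ Dq).
  have E1 : 12 * h * r = 3 * (4 * h * r) by ring.
  have E2 : 99 * h = 3 * h + 24 * (4 * h * r / r) by field.
  by rewrite E1 E2; split => //; [apply: c1|apply: c2] => i hi;
    have [] := AB i j q Uq hi qj.
pose Y (w : int -> pt -> R) := ladder (fun q : pt => q 0 1 / r) (fun j q => r^-1 * Hv j q) w.
have hY q (w : int -> pt -> R) : U q ->
    (forall j : int, `|q 0 1 / r - j%:~R| < 2 -> C1grad fx fy (w j) q) ->
    C1grad fx fy (Y w) q /\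
    forall g a b e et,
      (forall j : int, `|q 0 1 / r - j%:~R| < 2 -> C1close (w j) q g a b e et) ->
      C1close (Y w) q g a b (3 * e) (3 * et + 24 * (e / r)).
  move=> Uq; have Dq := UD _ Uq.
  apply: coord_ladder => //; first exact: D_fcont.
  - apply: filterS (Unear _ Uq) => q' Uq' j hj.
    have [_ _ _ [+ _ _]] := hH j q' Uq' hj.
    by move=> /le_trans; apply; exact: hr.
  - move=> j hj; have [_ gH _ cH] := hH j q Uq hj.
    by have [b1 b2] := bnd _ _ _ _ _ _ _ cH n0 n1 h99.
exists (Y Hu), (Y Hv) => p Kp.
have Up := nbhs_singleton (KU _ Kp).
have [g1 c1] : _ /\ _ := hY p Hu Up (fun j hj => let: And4 g _ _ _ := hH j p Up hj in g).
have [g2 c2] : _ /\ _ := hY p Hv Up (fun j hj => let: And4 _ g _ _ := hH j p Up hj in g).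
have E : 3 * (99 * h) + 24 * (12 * h * r / r) = 585 * h by field.
have hre : 3 * (12 * h * r) <= eta.
  have -> : 3 * (12 * h * r) = 36 * h * r by ring.
  by apply: le_trans h36; rewrite ler_piMr // mulr_ge0 // ltW.
have W w g a b : C1close w p g a b (3 * (12 * h * r)) (3 * (99 * h) + 24 * (12 * h * r / r)) ->
    C1close w p g a b eta eta.
  by rewrite E => -[H1 H2 H3]; split;
    [exact: le_trans H1 hre|exact: le_trans H2 h585|exact: le_trans H3 h585].
split => //; apply: W; [apply: c1|apply: c2] => j hj;
  by have [] := hH j p Up hj.
Qed.
End Grid.

(** * Maps of a convex planar domain close to the identity *)

(** Lets matrices be used as a complete normed space, as the fixed point
    theorem requires. *)
HB.instance Definition _ (R : realType) (m n : nat) :=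
  Complete.on 'M[R]_(m, n).

Section NearIdentity.
Variable R : realType.
Notation pt := 'rV[R]_2.
Variables (D : set pt) (u v : pt -> R).
Hypothesis oD : open D.
Hypothesis convD : forall p q (t : R), D p -> D q -> 0 <= t <= 1 ->
  D (p + t *: (q - p)).
Hypothesis uC1 : forall p, D p -> C1_at u p.
Hypothesis vC1 : forall p, D p -> C1_at v p.
Hypothesis uv_close : forall p, D p -> exists e : R,
  [/\ C1close u p (p 0 0) 1 0 e (1 / 8), C1close v p (p 0 1) 0 1 e (1 / 8) &
      forall q, `|q - p| <= 2 * e -> D q].
Implicit Types (p q y z : pt).

Definition planar : pt -> pt := fun p => u p *: e_x R + v p *: e_y R.

Lemma planarE p : (planar p 0 0 = u p) * (planar p 0 1 = v p).
Proof. by rewrite /planar !mxE /= !mulr1 !mulr0 addr0 add0r. Qed.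

(** Each coordinate of the displacement has partial derivatives at most
    1/8, hence Lipschitz constant 1/4 on the convex set [D]. *)
Lemma displacement_lipschitz p q : D p -> D q ->
  `|(planar q - q) - (planar p - p)| <= 1 / 4 * `|q - p|.
Proof.
move=> Dp Dq.
have H (w g : pt -> R) (a b : R) : (forall z, D z -> C1_at w z) ->
    (forall z, partials g z a b) ->
    (forall z, D z -> `|dx w z - a| <= 1 / 8 /\ `|dy w z - b| <= 1 / 8) ->
    `|(w q - g q) - (w p - g p)| <= 1 / 4 * `|q - p|.
  move=> Cw dg Hw.
  have dwg z : D z -> partials (fun r => w r + -1 * g r) z (dx w z - a) (dy w z - b).
    move=> Dz.
    apply: partials_eq (partialsD (C1_at_partials (Cw z Dz))
      (partialsM (partials_cst (-1) z) (dg z))) _ _.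
    - by rewrite mulr0 addr0 mulN1r.
    - by rewrite mulr0 addr0 mulN1r.
  rewrite -![- g _]mulN1r.
  have -> : 1 / 4 = 2 * (1 / 8) :> R by field.
  apply: (@mean_value _ (fun r => w r + -1 * g r)) => t t01.
  have Dz := convD Dp Dq t01.
  have [dz -> ->] := dwg _ Dz.
  by have [] := Hw _ Dz.
rewrite pt_norm_le !ptB !planarE; apply/andP; split.
- apply: (H u (fun r => r 0 0) 1 0) => //; first exact: partials_x.
  by move=> z /uv_close[e [[_ ? ?] _ _]].
- apply: (H v (fun r => r 0 1) 0 1) => //; first exact: partials_y.
  by move=> z /uv_close[e [_ [_ ? ?] _]].
Qed.

Lemma planar_expand p q : D p -> D q -> `|q - p| <= 4 / 3 * `|planar q - planar p|.
Proof.
move=> Dp Dq; have := displacement_lipschitz Dp Dq.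
have : `|q - p| <= `|planar q - planar p| + `|(planar q - q) - (planar p - p)|.
  have E : q - p = (planar q - planar p) - ((planar q - q) - (planar p - p)).
    by apply/rowP => j; rewrite !mxE; ring.
  by rewrite {1}E; exact: ler_normB.
by lra.
Qed.

Lemma planar_small p : D p -> exists e : R,
  [/\ 0 <= e, `|planar p - p| <= e & forall q, `|q - p| <= 2 * e -> D q].
Proof.
move=> /uv_close[e [[hu _ _] [hv _ _] H]]; exists e; split => //.
  by apply: le_trans hu.
by rewrite pt_norm_le !ptB !planarE hu hv.
Qed.

Lemma planar_D p : D p -> D (planar p).
Proof.
by move=> /planar_small[e [e0 h H]]; apply: H; apply: le_trans h _; lra.
Qed.

(** A preimage of [y] is a fixed point of [z |-> y - (planar z - z)]. This
    map is a contraction, and it preserves the ball around [y] whose radius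
    is twice the bound on the displacement of [y]; that ball lies in [D]. *)
Lemma planar_surj y : D y -> exists2 z, D z & planar z = y.
Proof.
move=> Dy; have [e [e0 hy H]] := planar_small Dy.
pose B := [set z : pt | `|z - y| <= 2 * e].
have BD z : B z -> D z by exact: H.
pose T (z : pt) : pt := y - (planar z - z).
have TB : {homo T : z / B z >-> B z}.
  move=> z Bz; rewrite /B /= /T addrC addKr normrN.
  have := displacement_lipschitz Dy (BD _ Bz).
  have : `|planar z - z| <= `|planar y - y| + `|(planar z - z) - (planar y - y)|.
    by rewrite -{1}(subrK (planar y - y) (planar z - z)) addrC; exact: ler_normD.
  by move: Bz; rewrite /B /=; lra.
have ctr : is_contraction (mkfun TB).
  exists (1 / 4)%:nng; split; first by rewrite /=; lra.
  move=> [z z'] [/= Bz Bz']; rewrite /T.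
  have E (a b c : pt) : a - b - (a - c) = c - b by rewrite opprB addrC subrKA.
  rewrite /= E.
  rewrite [X in _ <= _ * X]distrC; exact: (displacement_lipschitz (BD _ Bz) (BD _ Bz')).
have clB : closed B.
  have -> : B = (fun z => `|z - y|) @^-1` [set x | x <= 2 * e] by [].
  apply: closed_comp; last exact: closed_le.
  move=> z _; suff : cont_at (fun z : pt => `|z - y|) z by [].
  apply: (cont_comp (s := fun z : pt => z - y) (t := Num.norm)).
    by apply: continuousB; [exact: cvg_id|exact: cst_continuous].
  exact: norm_continuous.
have By : B y by rewrite /B /= subrr normr0 mulr_ge0.
have [z Bz zT] := banach_fixed_point ctr clB (ex_intro _ y By).
exists z; first exact: BD.
have zE : z = y - (planar z - z) by exact: zT.
have : z + (planar z - z) = y by rewrite {1}zE subrK.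
by rewrite addrC subrK.
Qed.

Definition jac p := dx u p * dy v p - dy u p * dx v p.

Lemma jac_bound p : D p ->
  [/\ 3 / 4 <= jac p, `|dx u p| <= 9 / 8, `|dy u p| <= 9 / 8,
      `|dx v p| <= 9 / 8 & `|dy v p| <= 9 / 8].
Proof.
move=> /uv_close[e [[_ + +] [_ + +] _]]; rewrite /jac.
move: (dx u p) (dy u p) (dx v p) (dy v p) => a b c d.
rewrite !subr0 !ler_norml => /andP[a0 a1] /andP[b0 b1] /andP[c0 c1] /andP[d0 d'].
have H1 : 49 / 64 <= a * d.
  have : 0 <= (a - 7 / 8) * (d - 7 / 8) by apply: mulr_ge0; lra.
  by lra.
have H2 : b * c <= 1 / 64.
  have : 0 <= (1 / 8 - b) * (1 / 8 + c) by apply: mulr_ge0; lra.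
  have : 0 <= (1 / 8 + b) * (1 / 8 - c) by apply: mulr_ge0; lra.
  by lra.
by split; lra.
Qed.

Variable rho : pt -> pt.
Hypothesis rho_inv : forall y, D y -> D (rho y) /\ planar (rho y) = y.

Lemma rho_lipschitz y y' : D y -> D y' -> `|rho y' - rho y| <= 4 / 3 * `|y' - y|.
Proof.
move=> /rho_inv[D1 {2}<-] /rho_inv[D2 {2}<-]; exact: planar_expand.
Qed.

Lemma rhoK p : D p -> rho (planar p) = p.
Proof.
move=> Dp; have [D1 E] := rho_inv (planar_D Dp).
have := planar_expand Dp D1; rewrite E subrr normr0 mulr0 normr_le0 subr_eq0.
by move/eqP.
Qed.

Lemma rho_near y (P : pt -> Prop) : D y -> (\forall z \near rho y, P z) ->
  \forall y' \near y, P (rho y').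
Proof.
move=> Dy /nbhs_ballP[r /= r0 H].
have /nbhs_ballP[s /= s0 Ds] : nbhs y D by exact: open_nbhs_nbhs.
apply/nbhs_ballP; exists (Num.min s (r / 2)).
  by rewrite /= lt_min s0 divr_gt0.
move=> y'; rewrite -ball_normE /= lt_min => /andP[ys yr].
have Dy' : D y' by apply: Ds; rewrite -ball_normE.
apply: H; rewrite -ball_normE /=.
apply: le_lt_trans (rho_lipschitz Dy' Dy) _.
by move: yr; lra.
Qed.

Lemma rho_cont y : D y -> cont_at rho y.
Proof. by move=> Dy P HP; exact: (rho_near Dy HP). Qed.

(** In the first-order expansions of [u] and [v] at [rho y], an increment
    of [rho] and the corresponding increment of its argument have
    comparable norms, because [rho] is Lipschitz. Solving the resulting 2
    by 2 system gives the expansion of [rho]. *)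
Lemma partials_rho y : D y -> let p := rho y in
  partials (fun q => rho q 0 0) y (dy v p / jac p) (- dy u p / jac p) /\
  partials (fun q => rho q 0 1) y (- dx v p / jac p) (dx u p / jac p).
Proof.
move=> Dy p; have [Dp Ep] := rho_inv Dy; rewrite -/p in Dp Ep.
have [J0 ux uy vx vy] := jac_bound Dp.
have /partialsP du := C1_at_partials (uC1 Dp); have /partialsP dv := C1_at_partials (vC1 Dp).
have key e : 0 < e -> \forall h \near (0 : pt),
    exists r1 r2 : R, [/\ `|r1| <= e * `|h|, `|r2| <= e * `|h| &
      let k := rho (h + y) - rho y in
      h 0 0 = k 0 0 * dx u p + k 0 1 * dy u p + r1 /\
      h 0 1 = k 0 0 * dx v p + k 0 1 * dy v p + r2].
  move=> e0; have e2 : 0 < 3 / 4 * e by rewrite mulr_gt0 // divr_gt0.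
  have H' : \forall z \near p, 
      `|u z - u p - ((z - p) 0 0 * dx u p + (z - p) 0 1 * dy u p)| <= 3 / 4 * e * `|z - p|
    /\ `|v z - v p - ((z - p) 0 0 * dx v p + (z - p) 0 1 * dy v p)| <= 3 / 4 * e * `|z - p|.
    have : \forall h \near (0 : pt), 
      `|u (h + p) - u p - (h 0 0 * dx u p + h 0 1 * dy u p)| <= 3 / 4 * e * `|h|
      /\ `|v (h + p) - v p - (h 0 0 * dx v p + h 0 1 * dy v p)| <= 3 / 4 * e * `|h|.
      exact: filterI (du _ e2) (dv _ e2).
    by move=> /(near_of0 p); apply: filterS => z /=; rewrite subrK.
  have nD : nbhs y D by exact: open_nbhs_nbhs.
  apply: filterS2 (near_to0 (rho_near Dy H')) (near_to0 nD) => h /= [h1 h2] Dh.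
  have [_ Eh] := rho_inv Dh.
  have L := rho_lipschitz Dy Dh; rewrite addrK -/p in L.
  have U z : u z = planar z 0 0 by rewrite planarE.
  have V z : v z = planar z 0 1 by rewrite planarE.
  rewrite (U (rho (h + y))) (U p) Eh Ep in h1.
  rewrite (V (rho (h + y))) (V p) Eh Ep in h2.
  have S j : (h + y) 0 j - y 0 j = h 0 j by rewrite mxE addrK.
  rewrite S in h1; rewrite S in h2; rewrite -/p.
  set k := rho (h + y) - p in h1 h2 L *.
  exists (h 0 0 - (k 0 0 * dx u p + k 0 1 * dy u p)),
         (h 0 1 - (k 0 0 * dx v p + k 0 1 * dy v p)).
  have eL : 3 / 4 * e * `|k| <= e * `|h|.
    have -> : e * `|h| = 3 / 4 * e * (4 / 3 * `|h|) by field.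
    by rewrite ler_wpM2l // ltW.
  split; [exact: le_trans h1 eL|exact: le_trans h2 eL|].
  by split; ring.
have J1 : 0 < jac p by apply: lt_le_trans J0; rewrite divr_gt0.
have Jn0 : jac p != 0 by rewrite gt_eqF.
have bnd (a b r1 r2 e : R) (h : pt) : 0 < e -> `|a| <= 9 / 8 -> `|b| <= 9 / 8 ->
    `|r1| <= e / 3 * `|h| -> `|r2| <= e / 3 * `|h| ->
    `|(r2 * b - r1 * a) / jac p| <= e * `|h|.
  move=> e0 ha hb h1 h2; rewrite normrM normfV (gtr0_norm J1).
  rewrite ler_pdivrMr //.
  apply: le_trans (ler_normB _ _) _; rewrite !normrM.
  have P1 : `|r1| * `|a| <= e / 3 * `|h| * (9 / 8) by apply: ler_pM.
  have P2 : `|r2| * `|b| <= e / 3 * `|h| * (9 / 8) by apply: ler_pM.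
  have eh : 0 <= e * `|h| by rewrite mulr_ge0 // ltW.
  apply: le_trans (lerD P2 P1) _.
  have -> : e / 3 * `|h| * (9 / 8) + e / 3 * `|h| * (9 / 8) = e * `|h| * (3 / 4).
    by field.
  by rewrite ler_wpM2l.
split; apply/partialsP => e e0; have e3 : 0 < e / 3 by rewrite divr_gt0.
- apply: filterS (key _ e3) => h [r1 [r2 [b1 b2 /= [E0 E1]]]].
  rewrite -/p in E0 E1; set k := rho (h + y) - p in E0 E1.
  rewrite -ptB -/p -/k.
  have -> : k 0 0 - (h 0 0 * (dy v p / jac p) + h 0 1 * (- dy u p / jac p))
    = (r2 * dy u p - r1 * dy v p) / jac p.
    by rewrite E0 E1; move: Jn0; rewrite /jac => Jn0; field.
  exact: (bnd _ _ _ _ _ _ e0 vy uy b1 b2).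
- apply: filterS (key _ e3) => h [r1 [r2 [b1 b2 /= [E0 E1]]]].
  rewrite -/p in E0 E1; set k := rho (h + y) - p in E0 E1.
  rewrite -ptB -/p -/k.
  have -> : k 0 1 - (h 0 0 * (- dx v p / jac p) + h 0 1 * (dx u p / jac p))
    = (r1 * dx v p - r2 * dx u p) / jac p.
    by rewrite E0 E1; move: Jn0; rewrite /jac => Jn0; field.
  exact: (bnd _ _ _ _ _ _ e0 ux vx b2 b1).
Qed.

Lemma C1_rho y : D y -> C1_at (fun q => rho q 0 0) y /\ C1_at (fun q => rho q 0 1) y.
Proof.
move=> Dy; have nD : \forall q \near y, D q by exact: open_nbhs_nbhs.
have nd : \forall q \near y,
    partials (fun q => rho q 0 0) q (dy v (rho q) / jac (rho q)) (- dy u (rho q) / jac (rho q)) /\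
    partials (fun q => rho q 0 1) q (- dx v (rho q) / jac (rho q)) (dx u (rho q) / jac (rho q)).
  by apply: filterS nD => q Dq; exact: (partials_rho Dq).
have comp (s : pt -> R) : (forall p, D p -> cont_at s p) ->
   \forall q \near y, cont_at (fun q => s (rho q) / jac (rho q)) q.
  move=> cs; apply: filterS nD => q Dq.
  have [Dr _] := rho_inv Dq; have cr := rho_cont Dq.
  have cj : cont_at jac (rho q).
    have [_ ux uy] := nbhs_singleton (uC1 Dr).
    have [_ vx vy] := nbhs_singleton (vC1 Dr).
    exact: (contB (contM ux vy) (contM uy vx)).
  have j0 : jac (rho q) != 0.
    have [J0 _ _ _ _] := jac_bound Dr.
    by rewrite gt_eqF //; apply: lt_le_trans J0; rewrite divr_gt0.
  have := cont_comp cr (contM (cs _ Dr) (contV j0 cj)); exact.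
have cu p : D p -> cont_at (dx u) p /\ cont_at (dy u) p.
  by move=> /uC1/nbhs_singleton[_ c1 c2].
have cv p : D p -> cont_at (dx v) p /\ cont_at (dy v) p.
  by move=> /vC1/nbhs_singleton[_ c1 c2].
split.
- apply: (@C1_atI _ _ (fun q => dy v (rho q) / jac (rho q))
    (fun q => - dy u (rho q) / jac (rho q))).
  + by apply: filterS nd => q [].
  + by apply: comp => p /cv[_ c]; exact: c.
  + apply: (comp (fun q => - dy u q)) => p /cu[_ c].
    exact: contN.
- apply: (@C1_atI _ _ (fun q => - dx v (rho q) / jac (rho q))
    (fun q => dx u (rho q) / jac (rho q))).
  + by apply: filterS nd => q [].
  + apply: (comp (fun q => - dx v q)) => p /cv[c _].
    exact: contN.
  + by apply: comp => p /cu[c _]; exact: c.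
Qed.
End NearIdentity.

(** * Rectangles and their exhaustion by compact boxes *)

Section Exhaustion.
Variable R : realType.
Implicit Types (x y r M : R).

Lemma C1RD (s s' t t' : R -> R) x : C1R s s' x -> C1R t t' x ->
  C1R (fun y => s y + t y) (fun y => s' y + t' y) x.
Proof.
move=> Hs Ht; apply: filterS2 Hs Ht => y [ds cs] [dt ct]; split.
  exact: is_deriveD.
exact: contD.
Qed.

Lemma C1RN (s s' : R -> R) x : C1R s s' (- x) ->
  C1R (fun y => s (- y)) (fun y => - s' (- y)) x.
Proof.
move=> Hs.
have cN y : cont_at (fun y : R => - y) y by exact: (contN cvg_id).
have : \forall y \near x, is_derive (- y : R) (1 : R) s (s' (- y)) /\ cont_at s' (- y).
  exact: (cN x _ Hs).
apply: filterS => y [ds cs]; split.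
  have := @is_derive1_comp _ s -%R y _ _ ds (is_deriveNid y 1).
  by rewrite mulrN1.
by apply: contN; exact: (cont_comp (cN y) cs).
Qed.

Lemma ereal_gt_near (a : \bar R) x : (a < x%:E)%E ->
  \forall y \near x, (a < y%:E)%E.
Proof.
case: a => [r|//|_].
  by rewrite lte_fin => /lt_nbhsr; apply: filterS => y; rewrite lte_fin.
by near=> y; exact: ltNyr.
Unshelve. all: by end_near. Qed.

(** The second clause says that [k] is proper at the end [a], with an
    explicit bound in place of compactness. *)
Definition exhausts_from (a : \bar R) (k k' k'' : R -> R) :=
  (forall x, (a < x%:E)%E -> [/\ C1R k k' x, C1R k' k'' x & 0 <= k x]) /\
  (forall M, exists2 l : R, (a < l%:E)%E &
     forall x, (a < x%:E)%E -> k x <= M -> l <= x).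

(** At a finite end point [r] the function is [1 / (x - r)], and at minus
    infinity it is the square. *)
Lemma exhaustion_from (a : \bar R) : (a < +oo)%E ->
  exists k k' k'', exhausts_from a k k' k''.
Proof.
case: a => [r _|//|_].
- pose i x := (x - r)^-1.
  exists i, (fun x => - (i x * i x)), (fun x => 2 * (i x * (i x * i x))).
  split=> [x|M].
    rewrite lte_fin => rx.
    have near_r : \forall y \near x, (r < y) by exact: lt_nbhsr.
    have n0 y : (r < y) -> (y - r != 0) by move=> ry; rewrite subr_eq0 gt_eqF.
    have ci y : (r < y) -> cont_at i y.
      move=> ry; apply: contV; first exact: n0.
      by apply: contB; [exact: cvg_id|exact: cont_cst].
    have di y : (r < y) -> is_derive (y : R) (1 : R) i (- (i y * i y)).
      move=> ry.
      have := is_deriveB (is_derive_id y (1 : R)) (is_derive_cst r y 1).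
      rewrite subr0 => dr.
      have := is_deriveV (n0 _ ry : (id - cst r) y != 0) dr.
      by rewrite /GRing.scale /= mulr1 -exprVn expr2.
    split; last by rewrite invr_ge0 subr_ge0 ltW.
    + apply: filterS near_r => y ry; split; first exact: di.
      by apply: contN; apply: contM; exact: ci.
    + apply: filterS near_r => y ry; split.
        have := is_deriveN (is_deriveM (di _ ry) (di _ ry)).
        rewrite /GRing.scale /=.
        have -> : - (i y * - (i y * i y) + i y * - (i y * i y)) =
          2 * (i y * (i y * i y)) by ring.
        exact.
      apply: contM; first exact: cont_cst.
      by apply: contM; [exact: ci|apply: contM; exact: ci].
  have M0 : 0 < `|M| + 1 by rewrite ltr_wpDl.
  exists (r + (`|M| + 1)^-1); first by rewrite lte_fin ltrDl invr_gt0.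
  move=> x; rewrite lte_fin => rx kM; have X0 : 0 < x - r by rewrite subr_gt0.
  rewrite addrC -lerBrDr -[leRHS]invrK lef_pV2 ?posrE ?invr_gt0 //.
  by rewrite (le_trans kM) // (le_trans (ler_norm M)) // lerDl.
- exists (fun x => x ^+ 2), (fun x => 2 * x), (fun=> 2).
  split=> [x _|M].
    split; last exact: sqr_ge0.
    + near=> y; split.
        have := is_deriveX 2 (is_derive_id y (1 : R)).
        by rewrite exprfctE expr1 /GRing.scale /= mulr1.
      by apply: contM; [exact: cont_cst|exact: cvg_id].
    + near=> y; split; last exact: cont_cst.
      have := is_deriveZ 2 (is_derive_id y (1 : R)).
      by rewrite /GRing.scale /= mulr1.
  exists (- (`|M| + 1)); first exact: ltNyr.
  move=> x _ xM; rewrite leNgt; apply/negP => xlt.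
  have := ler_norm M; have := normr_ge0 M; move: xM xlt; rewrite expr2.
  by nra.
Unshelve. all: by end_near. Qed.

Definition exhausts (a b : \bar R) (k k' k'' : R -> R) :=
  (forall x, (a < x%:E < b)%E -> [/\ C1R k k' x, C1R k' k'' x & 0 <= k x]) /\
  (forall M, exists l h : R, (forall x, l <= x <= h -> (a < x%:E < b)%E) /\
     forall x, (a < x%:E < b)%E -> k x <= M -> l <= x <= h).

(** The sum of a function for the lower end and of the reflection of one
    for the upper end. *)
Lemma exhaustion (a b : \bar R) : (a < b)%E -> exists k k' k'', exhausts a b k k' k''.
Proof.
move=> ab.
have [k [k' [k'' [Hk lk]]]] := exhaustion_from (lt_le_trans ab (leey b)).
have [m [m' [m'' [Hm lm]]]] : exists k k' k'', exhausts_from (- b)%E k k' k''.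
  apply: exhaustion_from.
  by rewrite lteNl; apply: le_lt_trans ab; exact: leNye.
have bN x : (x%:E < b)%E -> (- b < (- x)%:E)%E by rewrite EFinN lteN2.
exists (fun x => k x + m (- x)), (fun x => k' x - m' (- x)), (fun x => k'' x + m'' (- x)).
split=> [x /andP[ax xb]|M].
  have [C1 C2 k0] := Hk _ ax; have [E1 E2 m0] := Hm _ (bN _ xb).
  split; last exact: addr_ge0.
  - exact: (C1RD C1 (C1RN E1)).
  - have := C1RD C2 (C1RN (s := fun y => - m' y) (s' := fun y => - m'' y) (x := x) _).
    move=> H; have : C1R (fun y => k' y - m' (- y)) (fun y => k'' y - - m'' (- y)) x.
      apply: H; apply: filterS E2 => y [dy cy]; split; first exact: is_deriveN.
      exact: contN.
    by apply: filterS => y; rewrite opprK => -[? c]; split => //;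
      apply: cont_near c; near=> z; rewrite opprK.
have [l al Hl] := lk M; have [h bh Hh] := lm M.
exists l, (- h); split=> [x /andP[lx xh]|x /andP[ax xb] kM].
  rewrite (lt_le_trans al) ?lee_fin //=.
  by rewrite lteNl in bh; apply: le_lt_trans bh; rewrite -EFinN lee_fin.
have [_ _ k0] := Hk _ ax; have [_ _ m0] := Hm _ (bN _ xb).
rewrite Hl //=; last by apply: le_trans kM; rewrite lerDl.
by rewrite lerNr Hh //; [exact: bN|apply: le_trans kM; rewrite lerDr].
Unshelve. all: by end_near. Qed.

Lemma rectangle_open (D : set 'rV[R]_2) : is_rectangle D -> open D.
Proof.
move=> [a [b [c [d [_ _ ->]]]]]; rewrite openE => p /= [/andP[ap pb] /andP[cp pd]].
have up x (e : \bar R) : (x%:E < e)%E -> \forall y \near x, (y%:E < e)%E.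
  case: e => [r|_|//].
    by rewrite lte_fin => /lt_nbhsl; apply: filterS => y; rewrite lte_fin.
  by near=> y; exact: ltry.
have cc j : cont_at (fun q : 'rV[R]_2 => q 0 j) p by exact: coord_continuous.
have Ha := cont_near_pull (cc 0) (ereal_gt_near ap).
have Hb := cont_near_pull (cc 0) (up _ _ pb).
have Hc := cont_near_pull (cc 1) (ereal_gt_near cp).
have Hd := cont_near_pull (cc 1) (up _ _ pd).
apply: filterS2 (filterI Ha Hb) (filterI Hc Hd) => q [h1 h2] [h3 h4].
by rewrite /= h1 h2 h3 h4.
Unshelve. all: by end_near. Qed.

Lemma between_ereal (a b : \bar R) x y (t : R) : (a < x%:E < b)%E ->
  (a < y%:E < b)%E -> 0 <= t <= 1 -> (a < (x + t * (y - x))%:E < b)%E.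
Proof.
move=> /andP[ax xb] /andP[ay yb] /andP[t0 t1].
apply/andP; split.
  have [xy|yx] := lerP x y.
    apply: lt_le_trans ax _; rewrite lee_fin lerDl mulr_ge0 //; lra.
  apply: lt_le_trans ay _; rewrite lee_fin; nra.
have [xy|yx] := lerP x y.
  apply: le_lt_trans yb; rewrite lee_fin; nra.
apply: le_lt_trans xb; rewrite lee_fin; nra.
Qed.

Lemma rectangle_convex (D : set 'rV[R]_2) : is_rectangle D ->
  forall p q (t : R), D p -> D q -> 0 <= t <= 1 -> D (p + t *: (q - p)).
Proof.
move=> [a [b [c [d [_ _ ->]]]]] p q t [p0 p1] [q0 q1] t01; rewrite /= !mxE.
by split; apply: between_ereal.
Qed.
End Exhaustion.

(** * Approximating the coordinates on the whole rectangle *)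

Section Global.
Variables (R : realType).
Notation pt := 'rV[R]_2.
Variables (D : set pt) (f fx fy Vx Vy : 'I_3 -> pt -> R).
Hypothesis rectD : is_rectangle D.
Hypothesis fd : forall q, D q -> forall k, partials (f k) q (fx k q) (fy k q).
Hypothesis fc : forall q, D q -> forall k, cont_at (fx k) q /\ cont_at (fy k) q.
Hypothesis Vc : forall q, D q -> forall k, cont_at (Vx k) q /\ cont_at (Vy k) q.
Hypothesis Vdual : forall q, D q ->
  [/\ dot3 Vx fx q = 1, dot3 Vx fy q = 0, dot3 Vy fx q = 0 & dot3 Vy fy q = 1].
Implicit Types (p q c : pt) (w : pt -> R).

Lemma box_compact (l h l' h' : R) :
  compact [set q : pt | l <= q 0 0 <= h /\ l' <= q 0 1 <= h'].
Proof.
have := @rV_compact R 2 (fun j => if j == 0 then `[l, h]%classic else `[l', h']%classic).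
rewrite (_ : [set v | _] = [set q : pt | l <= q 0 0 <= h /\ l' <= q 0 1 <= h']).
  by apply => j; case: ifP => _; exact: segment_compact.
apply/seteqP; split=> q /=.
  by move=> H; have := H 0; have := H 1; rewrite /= !in_itv /=.
by move=> [q0 q1]; apply: ord2P; rewrite /= in_itv.
Qed.

Lemma C1close_le w p (g a b e eta e' eta' : R) : e <= e' -> eta <= eta' ->
  C1close w p g a b e eta -> C1close w p g a b e' eta'.
Proof.
by move=> ee ee' [H1 H2 H3]; split; [exact: le_trans ee|exact: le_trans ee'|exact: le_trans ee'].
Qed.

(** The level is a proper C2 function [kap] of the coordinates, and the
    approximate level [T i] is obtained by substituting the approximate
    coordinates in it. The precision [e i] is a small fraction of the scale
    [r i] on which [kap] and the distance to the boundary of [D] vary, and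
    of [r (i - 1)], since the member of index [i] also serves in the blend
    of index [i - 1]. *)
Lemma global_approx : exists u v : pt -> R, forall p, D p ->
  [/\ C1grad fx fy u p, C1grad fx fy v p &
   exists e : R, [/\ C1close u p (p 0 0) 1 0 e (1 / 8),
     C1close v p (p 0 1) 0 1 e (1 / 8) & forall q, `|q - p| <= 2 * e -> D q]].
Proof.
have oD := rectangle_open rectD.
have [a [b [c [d [ab cd DE]]]]] := rectD.
have [k1 [k1' [k1'' [K1 L1]]]] := exhaustion ab.
have [k2 [k2' [k2'' [K2 L2]]]] := exhaustion cd.
have inD q : D q -> (a < (q 0 0)%:E < b)%E /\ (c < (q 0 1)%:E < d)%E.
  by rewrite DE.
have Din q : (a < (q 0 0)%:E < b)%E -> (c < (q 0 1)%:E < d)%E -> D q.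
  by rewrite DE.
pose kap q := k1 (q 0 0) + k2 (q 0 1).
have ck q : D q -> [/\ cont_at kap q, cont_at (fun q => k1' (q 0 0)) q &
    cont_at (fun q => k2' (q 0 1)) q].
  move=> /inD[/K1[/nbhs_singleton[[A1 _] A2] _ _] /K2[/nbhs_singleton[[B1 _] B2] _ _]].
  have cc j : cont_at (fun q : pt => q 0 j) q by exact: coord_continuous.
  split; [apply: contD| |].
  - apply: (cont_comp (cc 0)); apply: differentiable_continuous.
    by apply/derivable1_diffP.
  - apply: (cont_comp (cc 1)); apply: differentiable_continuous.
    by apply/derivable1_diffP.
  - exact: (cont_comp (cc 0) A2).
  - exact: (cont_comp (cc 1) B2).
(* At the scale [r] the level [kap] is almost constant and its slope is at
   most [1 / r]. *)
pose tame (r : R) p := forall q, `|q - p| < r ->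
  [/\ D q, `|kap q - kap p| <= 1 / 8, `|k1' (q 0 0)| <= r^-1 &
      `|k2' (q 0 1)| <= r^-1].
have tame_uniform (K : set pt) : compact K -> K `<=` D ->
    exists r : R, [/\ 0 < r, r <= 1 & forall p, K p -> tame r p].
  move=> cK KD.
  have : \forall r \near (0 : R)^'+, K `<=` tame r.
    move/compact_near_coveringP: cK; apply => p Kp.
    have Dp := KD _ Kp; have [c0 c1 c2] := ck _ Dp.
    have [s [s0 Hs]] : exists s : R, 0 < s /\ forall q, `|q - p| < s ->
        [/\ D q, `|kap q - kap p| <= 1 / 16,
          `|k1' (q 0 0)| <= `|k1' (p 0 0)| + 1 & `|k2' (q 0 1)| <= `|k2' (p 0 1)| + 1].
      have N1 : \forall q \near p, `|kap p - kap q| <= 1 / 16.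
        by move/cvgrPdist_le : c0; apply; rewrite divr_gt0.
      have N2 : \forall q \near p, `|k1' (p 0 0) - k1' ((q : pt) 0 0)| <= 1.
        by move/cvgrPdist_le : c1; apply.
      have N3 : \forall q \near p, `|k2' (p 0 1) - k2' ((q : pt) 0 1)| <= 1.
        by move/cvgrPdist_le : c2; apply.
      have ND : \forall q \near p, D q by exact: open_nbhs_nbhs.
      have : \forall q \near p, [/\ D q, `|kap q - kap p| <= 1 / 16,
          `|k1' ((q : pt) 0 0)| <= `|k1' (p 0 0)| + 1 & `|k2' (q 0 1)| <= `|k2' (p 0 1)| + 1].
        apply: filterS2 (filterI ND N1) (filterI N2 N3) => q [Dq h1] [h2 h3].
        have tri (x y : R) : `|x - y| <= 1 -> `|y| <= `|x| + 1.
          move=> xy; rewrite -[y](subKr x); apply: le_trans (ler_normB _ _) _.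
          by rewrite lerD2l.
        by split; rewrite ?tri // distrC.
      move=> /nbhs_ballP[s /= s0 Hs]; exists s; split => // q qs.
      by apply: Hs; rewrite -ball_normE /= distrC.
    pose m := Num.min (s / 2) (Num.min (`|k1' (p 0 0)| + 1)^-1 (`|k2' (p 0 1)| + 1)^-1).
    have m0 : 0 < m by rewrite !lt_min divr_gt0 //= !invr_gt0 !ltr_wpDl.
    near=> p' r => q qp'.
    have p's : `|p' - p| < s / 2.
      near: p'; apply/nbhs_ballP; exists (s / 2) => /=; first by rewrite divr_gt0.
      by move=> z; rewrite -ball_normE /= distrC.
    have r0 : 0 < r by near: r; exact: nbhs_right_gt.
    have : r < m by near: r; exact: nbhs_right_lt.
    rewrite !lt_min => /and3P[rs r1 r2].
    have qp : `|q - p| < s.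
      by rewrite -(subrKA p') (splitr s) (le_lt_trans (ler_normD _ _)) // ltrD // (lt_trans qp').
    have [Dq e1 e2 e3] := Hs _ qp.
    have [_ e1' _ _] : [/\ D p', `|kap p' - kap p| <= 1 / 16,
        `|k1' (p' 0 0)| <= `|k1' (p 0 0)| + 1 & `|k2' (p' 0 1)| <= `|k2' (p 0 1)| + 1].
      by apply: Hs; apply: lt_trans p's _; rewrite ltr_pdivrMr // ltr_pMr // ltr1n.
    split => //.
    - rewrite -(subrKA (kap p)) (le_trans (ler_normD _ _)) //.
      have -> : 1 / 8 = 1 / 16 + 1 / 16 :> R by field.
      by rewrite lerD // distrC.
    - rewrite (le_trans e2) // -[leLHS]invrK lef_pV2 ?posrE ?invr_gt0 ?ltr_wpDl //.
      exact: ltW.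
    - rewrite (le_trans e3) // -[leLHS]invrK lef_pV2 ?posrE ?invr_gt0 ?ltr_wpDl //.
      exact: ltW.
  move=> H; near (0 : R)^'+ => r; exists r; split => //.
  - by near: r; exact: nbhs_right_ltW.
  - by near: r; exact: H.
(* Level sets of the ladder at distance less than 2 from [i] lie in [K i]. *)
have boxes (i : int) : exists K : set pt, [/\ compact K, K `<=` D &
    forall q, D q -> kap q <= i%:~R + 2 -> K q].
  have [l [h [A1 A2]]] := L1 (i%:~R + 2); have [l' [h' [B1 B2]]] := L2 (i%:~R + 2).
  exists [set q : pt | l <= q 0 0 <= h /\ l' <= q 0 1 <= h']; split.
  - exact: box_compact.
  - by move=> q /= [/A1 q0 /B1 q1]; exact: Din.
  - move=> q /inD[q0 q1] kq /=; have [_ _ p1] := K1 _ q0; have [_ _ p2] := K2 _ q1.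
    split; [apply: A2 => //|apply: B2 => //]; apply: le_trans kq; rewrite /kap.
      by rewrite lerDl.
    by rewrite lerDr.
have [K HK] := choice boxes.
have [r Hr] : {r : int -> R & forall i, [/\ 0 < r i, r i <= 1 &
    forall p, K i p -> tame (r i) p]}.
  apply: (@choice int R (fun i r => [/\ 0 < r, r <= 1 & forall p, K i p -> tame r p])) => i.
  by have [cK KD _] := HK i; exact: tame_uniform.
(* Any small constant would do: with this one the final error of the
   derivatives, at most [27 * k], is below 1/8. *)
have [k k0 kE] : exists2 k : R, 0 < k & 1000 * k = 1.
  by exists (1 / 1000); lra.
have k_lt1 : k < 1 by lra.
have k2_le : (1 + k) + (0 + k) <= 2 by lra.
have k2_le' : (0 + k) + (1 + k) <= 2 by lra.
have k27_le t : t <= k -> 3 * t + 24 * k <= 1 / 8 by lra.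
pose e i := Num.min (r i) (r (i - 1)) * k.
have e0 i : 0 < e i.
  by rewrite mulr_gt0 // lt_min; have [-> _ _] := Hr i; have [-> _ _] := Hr (i - 1).
have [uv Huv] : {uv : int -> (pt -> R) * (pt -> R) & forall i p, K i p ->
    [/\ C1grad fx fy (uv i).1 p, C1grad fx fy (uv i).2 p,
      C1close (uv i).1 p (p 0 0) 1 0 (e i) (e i) &
      C1close (uv i).2 p (p 0 1) 0 1 (e i) (e i)]}.
  apply: (@choice int ((pt -> R) * (pt -> R))%type
    (fun i (uv : (pt -> R) * (pt -> R)) => forall p, K i p ->
    [/\ C1grad fx fy uv.1 p, C1grad fx fy uv.2 p,
      C1close uv.1 p (p 0 0) 1 0 (e i) (e i) &
      C1close uv.2 p (p 0 1) 0 1 (e i) (e i)])) => i.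
  have [cK KD _] := HK i.
  have [u [v H]] := local_approx oD fd fc Vc Vdual cK KD (e0 i).
  by exists (u, v).
pose T i q := k1 ((uv i).1 q) + k2 ((uv i).2 q).
have e_r i : e i <= r i * k /\ e (i + 1) <= r i * k.
  rewrite /e !ler_pM2r // !ge_min lexx; split => //.
  by rewrite addrK lexx orbT.
pose W (g : (pt -> R) * (pt -> R) -> pt -> R) := ladder kap T (fun i => g (uv i)).
have key g (x : pt -> R) (al be : R) :
    (forall i p, K i p -> C1grad fx fy (g (uv i)) p) ->
    (forall i p, K i p -> C1close (g (uv i)) p (x p) al be (e i) (e i)) ->
    forall p, D p -> C1grad fx fy (W g) p /\
      let n := Num.floor (kap p) in
      C1close (W g) p (x p) al be (3 * (r n * k)) (1 / 8).
  move=> Hg Hc p Dp; have cf : fcont fx fy p by exact: (D_fcont oD fc Dp).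
  have KK i q : D q -> `|kap q - i%:~R| < 2 -> K i q.
    move=> Dq; rewrite ltr_norml => /andP[_ hi]; have [_ _ H] := HK i.
    by apply: H => //; rewrite -lerBlDl; exact: ltW.
  have near_id i q : K i q -> let q' := (uv i).1 q *: e_x R + (uv i).2 q *: e_y R in
      [/\ D q', `|kap q' - kap q| <= 1 / 8, `|k1' (q' 0 0)| <= (r i)^-1 &
      `|k2' (q' 0 1)| <= (r i)^-1] /\ ((q' 0 0 = (uv i).1 q) * (q' 0 1 = (uv i).2 q)).
    move=> Kq q'; have Q : (q' 0 0 = (uv i).1 q) * (q' 0 1 = (uv i).2 q).
      by rewrite /q' !mxE /= !mulr1 !mulr0 addr0 add0r.
    split => //; have [r0 _ Ht] := Hr i; apply: (Ht q Kq).
    have [_ _ [cu _ _] [cv _ _]] := Huv i q Kq.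
    have [er _] := e_r i.
    have lt_r y : y <= e i -> y < r i.
      by move=> ye; apply: le_lt_trans (le_trans ye er) _; rewrite gtr_pMr.
    by rewrite pt_norm_lt // !ptB !Q !lt_r.
  have TE i q : K i q -> T i q = kap ((uv i).1 q *: e_x R + (uv i).2 q *: e_y R).
    by move=> /near_id[_ [Q0 Q1]]; rewrite /T /kap Q0 Q1.
  have gT i q : D q -> K i q -> C1grad fx fy (T i) q /\
      partials (T i) q (k1' ((uv i).1 q) * dx (uv i).1 q + k2' ((uv i).2 q) * dx (uv i).2 q)
                 (k1' ((uv i).1 q) * dy (uv i).1 q + k2' ((uv i).2 q) * dy (uv i).2 q).
    move=> Dq Kq; have [[Dq' _ _ _] [Q0 Q1]] := near_id i q Kq.
    have [/K1[] + + _ /K2[] + + _] := inD _ Dq'; rewrite Q0 Q1 => s1 s1' s2 s2'.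
    have [gu gv _ _] := Huv i q Kq.
    have cfq : fcont fx fy q by exact: (D_fcont oD fc Dq).
    split.
      exact: (C1gradD (C1grad_comp s1 s1' (C1grad_C1 cfq gu) gu)
                      (C1grad_comp s2 s2' (C1grad_C1 cfq gv) gv)).
    have [d1' _] := nbhs_singleton s1; have [d2' _] := nbhs_singleton s2.
    exact: (partialsD (partials_comp d1' (partials_diff (C1grad_diff gu)))
                (partials_comp d2' (partials_diff (C1grad_diff gv)))).
  have nD : \forall q \near p, D q by exact: open_nbhs_nbhs.
  have [ckp _ _] := ck _ Dp.
  have [] := @C1grad_ladder _ fx fy kap T (fun i => g (uv i)) p cf ckp.
  - apply: filterS nD => q Dq i hi; have Kq := KK _ _ Dq hi.
    by rewrite TE //; have [[_ ? _ _] _] := near_id _ _ Kq.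
  - move=> i hi; have Kp := KK _ _ Dp hi.
    by split; [have [] := gT i p Dp Kp|exact: Hg].
  move=> H1 H2; split => // n.
  have /andP[np pn] := floor_itv (kap p); rewrite -/n intrD in np pn.
  have Kn : K n p by apply: KK => //; rewrite ltr_norml; lra.
  have Kn1 : K (n + 1) p by apply: KK => //; rewrite ltr_norml intrD; lra.
  have [r0 r1 _] := Hr n; have [e1 e2] := e_r n.
  have C0 := C1close_le e1 e1 (Hc n p Kn).
  have C1 := C1close_le e2 e2 (Hc (n + 1) p Kn1).
  have [_ [_ dTx dTy]] := gT n p Dp Kn.
  have [[_ _ b1 b2] [Q0 Q1]] := near_id n p Kn; rewrite Q0 Q1 in b1 b2.
  have [_ _ [_ ux uy] [_ vx vy]] := Huv n p Kn.
  have rk : r n * k <= k by rewrite ler_piMl // ltW.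
  have e8 : e n <= k by exact: le_trans rk.
  have L (x1 x2 y1 y2 s t : R) : `|x1| <= y1 -> `|x2| <= y2 -> `|s| <= (r n)^-1 ->
      `|t| <= (r n)^-1 -> y1 + y2 <= 2 -> `|s * x1 + t * x2| <= 2 / r n.
    move=> hx1 hx2 hs ht y12; rewrite (le_trans (ler_normD _ _)) // !normrM.
    apply: le_trans (_ : (r n)^-1 * y1 + (r n)^-1 * y2 <= _).
      by rewrite lerD // ler_pM.
    by rewrite -mulrDr mulrC ler_pM2r ?invr_gt0.
  have sh (s t : R) : `|s - t| <= e n -> `|s| <= `|t| + k.
    move=> st; rewrite -[s](subrK t) addrC (le_trans (ler_normD _ _)) // lerD2l.
    exact: le_trans e8.
  have Lx : `|dx (T n) p| <= 2 / r n.
    rewrite dTx; apply: (L _ _ _ _ _ _ _ _ b1 b2 k2_le).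
      by rewrite -(normr1 R); exact: sh.
    by rewrite -(normr0 R); exact: sh.
  have Ly : `|dy (T n) p| <= 2 / r n.
    rewrite dTy; apply: (L _ _ _ _ _ _ _ _ b1 b2 k2_le').
      by rewrite -(normr0 R); exact: sh.
    by rewrite -(normr1 R); exact: sh.
  have := H2 _ _ _ _ _ _ C0 C1 Lx Ly; apply: C1close_le => //.
  have -> : 12 * (2 / r n * (r n * k)) = 24 * k.
    by field; rewrite gt_eqF.
  exact: k27_le.
exists (W fst), (W snd) => p Dp.
have [gu cu] := key fst (fun q => q 0 0) 1 0
  (fun i p Kp => let: And4 h _ _ _ := Huv i p Kp in h)
  (fun i p Kp => let: And4 _ _ h _ := Huv i p Kp in h) p Dp.
have [gv cv] := key snd (fun q => q 0 1) 0 1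
  (fun i p Kp => let: And4 _ h _ _ := Huv i p Kp in h)
  (fun i p Kp => let: And4 _ _ _ h := Huv i p Kp in h) p Dp.
split => //; move: cu cv; set n := Num.floor (kap p) => /= cu cv.
exists (3 * (r n * k)); split => // q qp.
have [r0 _ Ht] := Hr n; have [_ _ HKn] := HK n.
have /andP[np pn] := floor_itv (kap p); rewrite -/n intrD in np pn.
have Kp : K n p by apply: HKn => //; lra.
have [] // := Ht p Kp q; apply: le_lt_trans qp _.
have : r n * (6 * k) < r n by rewrite gtr_pMr //; lra.
have -> : 2 * (3 * (r n * k)) = r n * (6 * k) by ring.
by [].
Unshelve. all: by end_near. Qed.
End Global.

(** * Dual frames and Jacobians *)

Section Reparam.
Variable R : realType.
Notation pt := 'rV[R]_2.
Implicit Types (p q : pt).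

Lemma C1_on_planar (D : set pt) (u v : pt -> R) : open D ->
  (forall p, D p -> C1_at u p) -> (forall p, D p -> C1_at v p) ->
  C1_on D (planar u v).
Proof.
move=> oD cu cv; apply/(C1_on_rowP _ oD); apply: ord2P; apply/(C1_onP _ oD) => p Dp.
- by apply: C1_at_eq (cu p Dp); near=> q; rewrite planarE.
- by apply: C1_at_eq (cv p Dp); near=> q; rewrite planarE.
Unshelve. all: by end_near. Qed.

(** The chain rule applied to [s \o r], the identity near [p], shows that
    the Jacobian matrix of [r] is invertible. *)
Lemma jacobian_comp_inverse n (D : set pt) (g : pt -> 'rV[R]_n) (r s : pt -> pt) p :
  open D -> D p -> differentiable r p -> differentiable s (r p) ->
  differentiable g (r p) -> (forall q, D q -> s (r q) = q) ->
  \rank ('J (g \o r) p) = \rank ('J g (r p)).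
Proof.
move=> oD Dp dr ds dg sr.
have Jd k m (h : 'rV[R]_k -> 'rV[R]_m) x z : z *m 'J h x = 'd h x z.
  exact: mul_rV_lin1.
have JE m (h : pt -> 'rV[R]_m) : differentiable h (r p) ->
    'J (h \o r) p = 'J r p *m 'J h (r p).
  move=> dh; apply/row_matrixP => i; rewrite !rowE mulmxA !Jd.
  exact: (congr1 (fun F : pt -> 'rV[R]_m => F (delta_mx 0 i)) (diff_comp dr dh)).
have JI : 'J r p *m 'J s (r p) = 1%:M.
  rewrite -(JE _ _ ds); apply/row_matrixP => i; rewrite !rowE mulmx1 Jd.
  rewrite -(deriveE _ (differentiable_comp dr ds)).
  rewrite (@near_eq_derive _ _ _ (s \o r) id) ?derive_id //.
  have : \forall q \near p, D q by exact: open_nbhs_nbhs.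
  by apply: filterS => q /sr.
have [uJ _] := mulmx1_unit JI.
by rewrite (JE _ _ dg) eqmxMfull // row_full_unit.
Qed.
End Reparam.

Section Frame.
Variable R : realType.
Implicit Types (V W N : 'rV[R]_3).

Definition cr (V W : 'I_3 -> R) (k : 'I_3) : R :=
  V (k + 1) * W (k + 2) - V (k + 2) * W (k + 1).

Lemma sum3 (g : 'I_3 -> R) : \sum_(k < 3) g k = g 0 + g 1 + g 2.
Proof.
rewrite !big_ord_recr big_ord0 /= add0r.
by congr (g _ + g _ + g _); apply/val_inj.
Qed.

Lemma ord3_shift : ((0 : 'I_3) + 1 = 1) * ((0 : 'I_3) + 2 = 2) * ((1 : 'I_3) + 1 = 2)
  * ((1 : 'I_3) + 2 = 0) * ((2 : 'I_3) + 1 = 0) * ((2 : 'I_3) + 2 = 1).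
Proof. by do !split; apply/val_inj. Qed.

Lemma ord3P (P : 'I_3 -> Prop) : P 0 -> P 1 -> P 2 -> forall k, P k.
Proof.
move=> P0 P1 P2 [[|[|[|//]]] Hk].
- by rewrite (_ : Ordinal Hk = 0) //; apply/val_inj.
- by rewrite (_ : Ordinal Hk = 1) //; apply/val_inj.
- by rewrite (_ : Ordinal Hk = 2) //; apply/val_inj.
Qed.

(** Gram-Schmidt for two unit vectors: [a - c b] is orthogonal to [b], and
    its product with [a] is the Gram determinant [1 - c * c]. *)
Lemma dual_basis (a b : 'I_3 -> R) (c g : R) :
  \sum_(k < 3) a k * a k = 1 -> \sum_(k < 3) b k * b k = 1 ->
  \sum_(k < 3) a k * b k = c -> (1 - c * c) * g = 1 ->
  \sum_(k < 3) (a k - c * b k) * g * a k = 1 /\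
  \sum_(k < 3) (a k - c * b k) * g * b k = 0.
Proof.
move=> aa bb ab gE.
have lin (h : 'I_3 -> R) : \sum_(k < 3) (a k - c * b k) * g * h k =
    (\sum_(k < 3) a k * h k - c * \sum_(k < 3) b k * h k) * g.
  by rewrite !sum3; ring.
have ba : \sum_(k < 3) b k * a k = c.
  by rewrite -ab; apply: eq_bigr => k _; rewrite mulrC.
by rewrite !lin aa ba ab bb mulr1 subrr mul0r.
Qed.

(** [X wy - Y wx] is the cross product of [W] with [X x Y], by the triple
    product formula, and [N] is proportional to [X x Y]; likewise [J] is
    the scalar product of [V x W] with [X x Y]. *)
Lemma dual_frame (X Y V W N : 'I_3 -> R) (s : R) : s != 0 ->
  (forall k, N k = s^-1 * cr X Y k) ->
  let vx := \sum_(k < 3) V k * X k in let vy := \sum_(k < 3) V k * Y k in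
  let wx := \sum_(k < 3) W k * X k in let wy := \sum_(k < 3) W k * Y k in
  let J := vx * wy - vy * wx in
  J != 0 ->
  let det := \sum_(k < 3) cr V W k * N k in
  [/\ det != 0, forall k, (X k * wy - Y k * wx) / J = cr W N k / det &
      forall k, (Y k * vx - X k * vy) / J = cr N V k / det].
Proof.
move=> s0 NE vx vy wx wy J J0 det.
have detE : det = s^-1 * J.
  rewrite /det /J /vx /vy /wx /wy !sum3 !NE /cr !ord3_shift; ring.
have d0 : det != 0 by rewrite detE mulf_neq0 // invr_eq0.
have E1 k : s * cr W N k = X k * wy - Y k * wx.
  rewrite /cr !NE /wx /wy !sum3 /cr; move: k.
  by apply: ord3P; rewrite !ord3_shift; field.
have E2 k : s * cr N V k = Y k * vx - X k * vy.
  rewrite /cr !NE /vx /vy !sum3 /cr; move: k.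
  by apply: ord3P; rewrite !ord3_shift; field.
split => // k.
- by rewrite -E1 detE; field; rewrite s0 J0.
- by rewrite -E2 detE; field; rewrite s0 J0.
Qed.
End Frame.

(** * The reparametrized immersion *)

Section Smoothing.
Variable R : realType.
Notation pt := 'rV[R]_2.
Variables (D : set pt) (f : pt -> 'rV[R]_3) (N : 'I_3 -> pt -> R) (s : pt -> R).
Let fx k q := dx f q 0 k.
Let fy k q := dy f q 0 k.
Hypothesis oD : open D.
Hypothesis fC1 : C1_on D f.
Hypothesis s_neq0 : forall q, D q -> s q != 0.
Hypothesis NE : forall q, D q -> forall k, N k q = (s q)^-1 * cr (fx ^~ q) (fy ^~ q) k.
Hypothesis NC1 : forall q, D q -> forall k, C1_at (N k) q.
Variables (u v : pt -> R) (rho : pt -> pt).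
Hypothesis gu : forall q, D q -> C1grad fx fy u q.
Hypothesis gv : forall q, D q -> C1grad fx fy v q.
Hypothesis jac_neq0 : forall q, D q -> jac u v q != 0.
Hypothesis rhoD : forall q, D q -> D (rho q).
Hypothesis rhoC1 : forall y, D y ->
  C1_at (fun q => rho q 0 0) y /\ C1_at (fun q => rho q 0 1) y.
Hypothesis rhod : forall y, D y -> let p := rho y in
  partials (fun q => rho q 0 0) y (dy v p / jac u v p) (- dy u p / jac u v p) /\
  partials (fun q => rho q 0 1) y (- dx v p / jac u v p) (dx u p / jac u v p).

Lemma nearD p : D p -> \forall q \near p, D q.
Proof. by move=> Dp; exact: open_nbhs_nbhs. Qed.

Lemma partials_coord p k : D p -> partials (fun q => f q 0 k) p (fx k p) (fy k p).
Proof.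
move=> Dp; case: fC1 => /(_ _ Dp) df _ _.
by split; [move/differentiable_rowP : df; apply|rewrite /fx /dx derive_row|
  rewrite /fy /dy derive_row].
Qed.

(** The two quotients are the partial derivatives of [f \o rho], read at
    the image under [rho]. They only involve the continuous fields [fx] and
    [fy], but [dual_frame] expresses them through [N] and the gradients of
    [u] and [v], which are C1. *)
Lemma frame_C1 p k : D p ->
  C1_at (fun q => (fx k q * dy v q - fy k q * dx v q) / jac u v q) p /\
  C1_at (fun q => (fy k q * dx u q - fx k q * dy u q) / jac u v q) p.
Proof.
move=> Dp; have [V [CV HV]] := gu Dp; have [W [CW HW]] := gv Dp.
have CN := NC1 Dp.
have Ccr (A B : 'I_3 -> pt -> R) j : (forall i, C1_at (A i) p) ->
    (forall i, C1_at (B i) p) -> C1_at (fun q => cr (A ^~ q) (B ^~ q) j) p.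
  move=> CA CB.
  exact: (C1_atB (C1_atM (CA _) (CB _)) (C1_atM (CA _) (CB _))).
pose det q := \sum_(j < 3) cr (V ^~ q) (W ^~ q) j * N j q.
have Cdet : C1_at det p.
  by apply: C1_at_sum => j; apply: (C1_atM (Ccr V W j CV CW)); exact: CN.
have E : \forall q \near p, det q != 0 /\
   (fx k q * dy v q - fy k q * dx v q) / jac u v q = cr (W ^~ q) (N ^~ q) k / det q /\
   (fy k q * dx u q - fx k q * dy u q) / jac u v q = cr (N ^~ q) (V ^~ q) k / det q.
  apply: filterS3 HV HW (nearD Dp) => q [_ ux uy] [_ vx vy] Dq.
  have := jac_neq0 Dq; rewrite /jac ux uy vx vy => J0.
  have [d0 E1 E2] := @dual_frame R (fx ^~ q) (fy ^~ q) (V ^~ q) (W ^~ q) (N ^~ q) _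
    (s_neq0 Dq) (NE Dq) J0.
  by split; [exact: d0|split; [exact: E1|exact: E2]].
have [d0 _] := nbhs_singleton E.
have Cinv := C1_atV d0 Cdet.
split.
- apply: C1_at_eq (C1_atM (Ccr W N k CW CN) Cinv).
  by apply: filterS E => q [_ [-> _]].
- apply: C1_at_eq (C1_atM (Ccr N V k CN CV) Cinv).
  by apply: filterS E => q [_ [_ ->]].
Qed.

Lemma smoothed_C2 : C2_on D (f \o rho).
Proof.
have dcomp p k : D p -> partials (fun q => (f \o rho) q 0 k) p
    ((fx k (rho p) * dy v (rho p) - fy k (rho p) * dx v (rho p)) / jac u v (rho p))
    ((fy k (rho p) * dx u (rho p) - fx k (rho p) * dy u (rho p)) / jac u v (rho p)).
  move=> Dp; have [d0' d1'] := rhod Dp.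
  have := partials_comp2 (partials_coord k (rhoD Dp)) d0' d1'.
  by move=> /partials_eq; apply; ring.
have dfr p : D p -> differentiable (f \o rho) p.
  by move=> Dp; apply/differentiable_rowP => k; case: (dcomp p k Dp).
split; apply/(C1_on_rowP _ oD) => k; apply/(C1_onP _ oD) => p Dp;
  have [c0 c1] := rhoC1 Dp.
- have Cf : C1_at (fun q => f q 0 k) (rho p).
    by move/(C1_on_rowP _ oD)/(_ k)/(C1_onP _ oD) : fC1; apply; exact: rhoD.
  exact: (C1_at_comp2 Cf c0 c1).
- have [C _] := frame_C1 k (rhoD Dp).
  apply: C1_at_eq (C1_at_comp2 C c0 c1).
  apply: filterS (nearD Dp) => q Dq; have [_ E _] := dcomp q k Dq.
  by rewrite -E /dx derive_row //; exact: dfr.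
- have [_ C] := frame_C1 k (rhoD Dp).
  apply: C1_at_eq (C1_at_comp2 C c0 c1).
  apply: filterS (nearD Dp) => q Dq; have [_ _ E] := dcomp q k Dq.
  by rewrite -E /dy derive_row //; exact: dfr.
Qed.
End Smoothing.

Lemma dot_unit_angle (R : realType) (a b : 'rV[R]_3) t :
  dot a a = 1 -> dot b b = 1 -> is_angle t a b -> dot a b = cos t.
Proof. by rewrite /is_angle /enorm => -> ->; rewrite sqrtr1 !mul1r. Qed.

Theorem theorem5p2 (R : realType) (D : set 'rV[R]_2)
    (f : 'rV[R]_2 -> 'rV[R]_3) (theta : 'rV[R]_2 -> R) :
  let N := normal theta f in
  is_rectangle D ->
  C1M_on D f ->
  regular_on D f ->
  chebyshev_on D f ->
  asymptotic_on D f N ->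
  (forall p, D p -> is_angle (theta p) (dx f p) (dy f p)) ->
  (forall p, D p -> 0 < theta p < pi) ->
  C1M_on D N ->
  (forall p, D p -> dy (dx N) p = cos (theta p) *: N p /\
                    dx (dy N) p = cos (theta p) *: N p) ->
  (forall p, D p -> dx f p = cross (N p) (dx N p) /\
                    dy f p = - cross (N p) (dy N p)) ->
  exists rho : 'rV[R]_2 -> 'rV[R]_2,
    [/\ C1_diffeo D rho, C2_on D (f \o rho) & regular_on D (f \o rho)].
Proof.
move=> N rectD [fC1 _ _ _ _] freg fche _ fang fth [NC1 _ _ _ _] _ _.
have oD := rectangle_open rectD; have cD := rectangle_convex rectD.
pose fx k q := dx f q 0 k; pose fy k q := dy f q 0 k.
have fd q : D q -> forall k, partials (fun q => f q 0 k) q (fx k q) (fy k q).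
  by move=> Dq k; exact: (partials_coord fC1 k Dq).
have fc q : D q -> forall k, cont_at (fx k) q /\ cont_at (fy k) q.
  move=> Dq k; case: fC1 => _ /(_ _ Dq)/continuous_rowP cx /(_ _ Dq)/continuous_rowP cy.
  by split; [exact: cx|exact: cy].
have sin0 q : D q -> sin (theta q) != 0.
  by move=> /fth/sin_gt0_pi s0; rewrite gt_eqF.
pose c q := \sum_(k < 3) fx k q * fy k q.
pose g q := 1 - c q * c q.
have cE q : D q -> c q = cos (theta q).
  by move=> Dq; have [n1 n2] := fche _ Dq; exact: (dot_unit_angle n1 n2 (fang _ Dq)).
have g0 q : D q -> g q != 0.
  move=> Dq; rewrite /g -expr2 cE // -(cos2Dsin2 (theta q)) addrC addKr.
  by rewrite expf_neq0 // sin0.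
have cc q : D q -> cont_at c q /\ cont_at (fun q => (g q)^-1) q.
  move=> Dq; have c1 : cont_at c q.
    by apply: cont_sum => k; have [] := fc _ Dq k; exact: contM.
  split => //; apply: contV; first exact: g0.
  by apply: contB; [exact: cont_cst|exact: (contM c1 c1)].
pose Vx k q := (fx k q - c q * fy k q) * (g q)^-1.
pose Vy k q := (fy k q - c q * fx k q) * (g q)^-1.
have Vc q : D q -> forall k, cont_at (Vx k) q /\ cont_at (Vy k) q.
  move=> Dq k; have [a b] := fc _ Dq k; have [c1 c2] := cc _ Dq.
  by split; [exact: (contM (contB a (contM c1 b)) c2)|
             exact: (contM (contB b (contM c1 a)) c2)].
have Vdual q : D q ->
    [/\ dot3 Vx fx q = 1, dot3 Vx fy q = 0, dot3 Vy fx q = 0 & dot3 Vy fy q = 1].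
  move=> Dq; have [n1 n2] := fche _ Dq.
  have gE : (1 - c q * c q) * (g q)^-1 = 1 by rewrite -/(g q) mulfV // g0.
  have n3 : \sum_(k < 3) fy k q * fx k q = c q.
    by apply: eq_bigr => k _; exact: mulrC.
  have [E1 E2] := dual_basis (a := fx ^~ q) (b := fy ^~ q) n1 n2 erefl gE.
  have [E3 E4] := dual_basis (a := fy ^~ q) (b := fx ^~ q) n2 n1 n3 gE.
  by split; [exact: E1|exact: E2|exact: E4|exact: E3].
have [u [v uv]] := global_approx rectD fd fc Vc Vdual.
have gu q : D q -> C1grad fx fy u q by move=> /uv[].
have gv q : D q -> C1grad fx fy v q by move=> /uv[].
have uC1 q : D q -> C1_at u q.
  by move=> Dq; exact: (C1grad_C1 (D_fcont oD fc Dq) (gu _ Dq)).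
have vC1 q : D q -> C1_at v q.
  by move=> Dq; exact: (C1grad_C1 (D_fcont oD fc Dq) (gv _ Dq)).
have uvc q : D q -> exists e : R, [/\ C1close u q (q 0 0) 1 0 e (1 / 8),
     C1close v q (q 0 1) 0 1 e (1 / 8) & forall z, `|z - q| <= 2 * e -> D z].
  by move=> /uv[].
have [rho rhoP] : {rho : 'rV[R]_2 -> 'rV[R]_2 &
    forall y, D y -> D (rho y) /\ planar u v (rho y) = y}.
  apply: (@choice _ _ (fun y z => D y -> D z /\ planar u v z = y)) => y.
  have [Dy|nDy] := pselect (D y); last by exists y.
  by have [z Dz zE] := planar_surj cD uC1 vC1 uvc Dy; exists z.
have rhoC1 := C1_rho oD cD uC1 vC1 uvc rhoP.
have rhod := partials_rho oD cD uC1 vC1 uvc rhoP.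
have crho : C1_on D rho.
  apply/(C1_on_rowP _ oD); apply: ord2P; apply/(C1_onP _ oD) => p /rhoC1[c0 c1].
    exact: c0.
  exact: c1.
have cOm := C1_on_planar oD uC1 vC1.
exists rho; split.
- exists (planar u v); split => // p Dp.
  + by split; [exact: (rhoP p Dp).1|exact: (planar_D uvc Dp)].
  + by split; [exact: (rhoP p Dp).2|exact: (rhoK cD uC1 vC1 uvc rhoP Dp)].
- apply: (@smoothed_C2 R D f (fun k q => N q 0 k) (sin \o theta) oD fC1 _ _ _ u v) => //.
  + by move=> q Dq k; rewrite /N /normal !mxE.
  + by move=> q Dq k; move/(C1_on_rowP _ oD)/(_ k)/(C1_onP _ oD): NC1; apply.
  + move=> q Dq; have [J0 _ _ _ _] := jac_bound uvc Dq.
    by rewrite gt_eqF //; apply: lt_le_trans J0; rewrite divr_gt0.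
  + by move=> q /rhoP[].
- move=> p Dp; have [Dr _] := rhoP p Dp.
  have [dr _ _] := crho; have [dO _ _] := cOm; have [df _ _] := fC1.
  rewrite (jacobian_comp_inverse oD Dp (dr _ Dp) (dO _ Dr) (df _ Dr)); first exact: freg.
  by move=> q /rhoP[].
Qed.
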